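(* Let $\Omega\subseteq\mathbb{R}^d$ be a nonempty closed convex set, and let $f:\mathbb{R}^d\to\mathbb{R}$ be convex and SPB with parameters $\mathrm{R}_1,\mathrm{R}_2,m$. Assume the problem $\min_{x\in\Omega}f(x)$ has an optimal solution $x^*$. Fix $\sigma>0$, $x^0\in\Omega$ and $\{\tau_k\}\subset(0,1]$, and generate $\{x^k\}$ by: for $k=0,1,2,\dots$, draw $u^k\sim\mathcal{N}(0,I)$ independently of the past, set $v^k=\sigma^{-1}[f(x^k+\sigma u^k)-f(x^k)]u^k$ and \[x^{k+1}=P_\Omega\Big(x^k-\tau_k\frac{v^k}{\|x^k\|^m+1}\Big).\] Then, with $\mathbb{E}$ denoting expectation over all the random vectors $u^0,u^1,\dots$, \[0\le\mathbb{E}[\|x^k-z\|^2]-\mathbb{E}[\|x^{k+1}-z\|^2]+\mathcal{H}_{(2)}\tau_k^2\qquad\forall z\in\mathop{\rm arg\,min}_{u\in\Omega}f_\sigma(u),\ \forall k\ge0,\] and for any integer $T>0$, \[\min_{0\le k\le T}\mathbb{E}\Big[\frac{f(x^k)-f(x^* )}{\|x^k\|^m+1}\Big]\le\frac{1}{2\sum_{k=0}^T\tau_k}\Big[\|x^0-x^*\|^2+\mathcal{H}_{(2)}\sum_{k=0}^T\tau_k^2\Big]+\mathcal{M}(x^* )\sigma,\] where $\mathcal{M}(x)=(2^{m-1}\mathrm{R}_1\|x\|^m+\mathrm{R}_2)\sqrt d+2^{m-1}\mathrm{R}_1\sigma^m(m+1+d)^{(m+1)/2}$ and $\mathcal{H}_{(2)}=3\max\big\{2^{2(m-1)}\mathrm{R}_1^2(4+d)^2,\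 \mathrm{R}_2^2(4+d)^2+2^{2(m-1)}\mathrm{R}_1^2\sigma^{2m}(2m+4+d)^{m+2}\big\}$.
   Context: $\mathcal{N}(0,I)$ is the $d$-dimensional standard Gaussian distribution; $\|\cdot\|$ the Euclidean norm; $P_\Omega$ the Euclidean projection onto $\Omega$. $f_\sigma(x)=\mathbb{E}_{u\sim\mathcal{N}(0,I)}[f(x+\sigma u)]$ is the Gaussian smoothing of $f$. $f$ is SPB with parameters $\mathrm{R}_1\ge0$, $\mathrm{R}_2>0$, integer $m\ge0$ (with $\mathrm{R}_1=0$ iff $m=0$) if $f$ is locally Lipschitz and $\sup_{\zeta\in\partial_Cf(x)}\|\zeta\|\le\mathrm{R}_1\|x\|^m+\mathrm{R}_2$ for all $x$, where $\partial_C f$ is the Clarke subdifferential (convention $0^0=1$). *)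

(* Defs.v *)
From HB Require Import structures.
From mathcomp Require Import all_boot all_order all_algebra.
From mathcomp Require Import all_classical all_reals all_analysis.
Set Implicit Arguments.
Unset Strict Implicit.
Unset Printing Implicit Defensive.
Import Order.TTheory GRing.Theory Num.Theory.
Import numFieldNormedType.Exports.
Local Open Scope classical_set_scope.
Local Open Scope ring_scope.

Section Defs.
Context {R : realType}.

Definition dotv {d : nat} (a b : 'rV[R]_d) : R := \sum_(i < d) a ord0 i * b ord0 i.
Definition enorm {d : nat} (a : 'rV[R]_d) : R := Num.sqrt (dotv a a).

Definition is_convex_set {d : nat} (A : set 'rV[R]_d) : Prop :=
  forall a b (t : R), A a -> A b -> 0 <= t <= 1 -> A (t *: a + (1 - t) *: b).

Definition is_convex_fun {d : nat} (f : 'rV[R]_d -> R) : Prop :=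
  forall a b (t : R), 0 <= t <= 1 ->
    f (t *: a + (1 - t) *: b) <= t * f a + (1 - t) * f b.

Definition is_projection {d : nat} (A : set 'rV[R]_d) (p : 'rV[R]_d -> 'rV[R]_d) : Prop :=
  forall y, A (p y) /\ (forall w, A w -> enorm (y - p y) <= enorm (y - w)).

Definition locally_lipschitz {d : nat} (f : 'rV[R]_d -> R) : Prop :=
  forall a, exists delta L : R, 0 < delta /\
    forall y z, enorm (y - a) < delta -> enorm (z - a) < delta ->
      `|f y - f z| <= L * enorm (y - z).

(* Clarke subdifferential:
   zeta \in d_C f(a)  iff  for all v, <zeta, v> <= f°(a; v), where
   f°(a; v) = limsup_{y -> a, t \downarrow 0} (f (y + t v) - f y) / t.
   "<zeta,v> <= limsup" is unfolded as: for every eps, delta > 0 there are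
   y, t with |y - a| < delta, 0 < t < delta and quotient > <zeta,v> - eps. *)
Definition clarke_subdiff {d : nat} (f : 'rV[R]_d -> R) (a : 'rV[R]_d) : set 'rV[R]_d :=
  [set zeta | forall (v : 'rV[R]_d) (eps delta : R), 0 < eps -> 0 < delta ->
     exists (y : 'rV[R]_d) (t : R), enorm (y - a) < delta /\ 0 < t < delta /\
       dotv zeta v - eps < (f (y + t *: v) - f y) / t].

(* SPB with parameters R1 >= 0, R2 > 0, m (R1 = 0 iff m = 0); 0^0 = 1 via ^+ *)
Definition SPB {d : nat} (f : 'rV[R]_d -> R) (R1 R2 : R) (m : nat) : Prop :=
  [/\ 0 <= R1, 0 < R2, (R1 = 0 <-> m = 0%N), locally_lipschitz f &
      forall a zeta, clarke_subdiff f a zeta -> enorm zeta <= R1 * enorm a ^+ m + R2].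

(* Expectation w.r.t. the d-dimensional standard Gaussian N(0, I), written as
   the iterated integral over the d independent N(0,1) coordinates. *)
Fixpoint gauss_expect (n : nat) : ('rV[R]_n -> \bar R) -> \bar R :=
  match n with
  | 0%N => fun g => g 0
  | n'.+1 => fun g =>
      (\int[normal_prob (0 : R) 1]_t gauss_expect
         (fun v : 'rV[R]_n' => g (row_mx (const_mx (t : R) : 'rV[R]_1) v : 'rV[R]_(1 + n'))))%E
  end.

Definition gauss_smooth {d : nat} (f : 'rV[R]_d -> R) (sigma : R) (a : 'rV[R]_d) : \bar R :=
  gauss_expect (fun u => (f (a + sigma *: u))%:E).

Definition Ex {d0 : measure_display} {T : measurableType d0} (P : probability T R)
  (X : T -> R) : \bar R := (\int[P]_w (X w)%:E)%E.

Definition mutually_independent {d0 : measure_display} {T : measurableType d0}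
  (P : probability T R) {I : eqType} (X : I -> T -> R) : Prop :=
  forall (s : seq I) (A : I -> set R), uniq s -> (forall i, measurable (A i)) ->
    P (\big[setI/setT]_(i <- s) (X i @^-1` A i)) = (\prod_(i <- s) P (X i @^-1` A i))%E.

Definition std_normal_law {d0 : measure_display} {T : measurableType d0}
  (P : probability T R) (X : T -> R) : Prop :=
  forall A : set R, measurable A -> P (X @^-1` A) = normal_prob 0 1 A.

End Defs.

(* Main.v *)
(** Write D = |x^k|^m + 1 and let f_s be the Gaussian smoothing of f. A convex
    f has subgradients, they lie in the Clarke subdifferential, and so the SPB
    bound gives |f(x+h) - f(x)| <= (C|x|^m + R2 + C|h|^m)|h| with
    C = 2^(m-1) R1. With the moment bound E|u|^p <= (p+d)^(p/2) this yields
    E|v|^2 <= H2 D^2 for the gradient estimator v, and f <= f_s with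
    f_s(x) <= f(x) + M(x) sigma. Moreover <E v, x - z> >= f_s(x) - f_s(z): this
    is the first-order part, as t -> 0, of convexity along the segment from x to
    z, after the translation by t(x - z) has been turned into the likelihood ratio
    of two Gaussians. Since the projection is nonexpansive and u^k is independent
    of x^k, for every z in Omega
      E|x^{k+1} - z|^2 <= E|x^k - z|^2 - 2 tau_k E[(f_s(x^k) - f_s(z))/D] + H2 tau_k^2.
    If z minimises f_s the middle term is nonpositive, and for z = x* summation
    over k gives the rate. *)

Require Import Defs.
From HB Require Import structures.
From mathcomp Require Import all_boot all_order all_algebra.
From mathcomp Require Import all_classical all_reals all_analysis.
From mathcomp Require Import measurable_realfun ring lra.
Import Order.TTheory GRing.Theory Num.Theory.
Import numFieldNormedType.Exports.
Local Open Scope classical_set_scope.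
Local Open Scope ring_scope.

Set Implicit Arguments.
Unset Strict Implicit.
Unset Printing Implicit Defensive.

(** * Euclidean geometry and convexity *)

(** The objective is not assumed differentiable, and its growth is only polynomial, so all
    integrands are kept in one class: functions bounded by C exp(s|u|^2) for every s > 0. It is
    stable under sums, products and translations, and all its members are Gaussian integrable. The
    Laplace transform of |u|^2 that proves integrability also yields the moments, with the exact
    second moment bound recovered from its behaviour as s tends to 0. The Gaussian measure is built
    one coordinate at a time, so that its translation formula and its Laplace transform reduce to
    dimension one. Independence of u^k and x^k is used by writing x^k as a fixed measurable function
    of the concatenated noise u^{k-1}, ..., u^0, whose law is Gaussian in dimension k d.
    Conditioning on the past then becomes Tonelli between two blocks of coordinates. Expectations
    along the process are extended reals. Their inequalities are written as sums of nonnegative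
    terms, and differences are formed only once finiteness is known. *)

Section euclidean.
Context {R : realType} {d : nat}.
Implicit Types a b c : 'rV[R]_d.

Lemma dotvC a b : dotv a b = dotv b a.
Proof. by apply: eq_bigr => i _; rewrite mulrC. Qed.

Lemma dotvDl a b c : dotv (a + b) c = dotv a c + dotv b c.
Proof. by rewrite -big_split; apply: eq_bigr => i _; rewrite !mxE mulrDl. Qed.

Lemma dotvZl (t : R) a b : dotv (t *: a) b = t * dotv a b.
Proof. by rewrite mulr_sumr; apply: eq_bigr => i _; rewrite !mxE mulrA. Qed.

Lemma dotvDr a b c : dotv c (a + b) = dotv c a + dotv c b.
Proof. by rewrite !(dotvC c) dotvDl. Qed.

Lemma dotvZr (t : R) a b : dotv a (t *: b) = t * dotv a b.
Proof. by rewrite !(dotvC a) dotvZl. Qed.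

Lemma dotvNl a b : dotv (- a) b = - dotv a b.
Proof. by rewrite -scaleN1r dotvZl mulN1r. Qed.

Lemma dotvNr a b : dotv a (- b) = - dotv a b.
Proof. by rewrite dotvC dotvNl dotvC. Qed.

Lemma dotv0r a : dotv a 0 = 0.
Proof. by rewrite -(scale0r a) dotvZr mul0r. Qed.

Lemma dotv_ge0 a : 0 <= dotv a a.
Proof. by apply: sumr_ge0 => i _; rewrite -expr2 sqr_ge0. Qed.

Lemma enorm_ge0 a : 0 <= enorm a.
Proof. exact: sqrtr_ge0. Qed.

Lemma enorm_sqr a : enorm a ^+ 2 = dotv a a.
Proof. by rewrite sqr_sqrtr// dotv_ge0. Qed.

Lemma enorm0 : enorm (0 : 'rV[R]_d) = 0.
Proof. by rewrite /enorm dotv0r sqrtr0. Qed.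

Lemma ler_abs_enorm a (i : 'I_d) : `|a ord0 i| <= enorm a.
Proof.
rewrite -(@ler_pXn2r _ 2) ?nnegrE ?enorm_ge0// enorm_sqr real_normK ?num_real//.
rewrite /dotv (bigD1 i)//= -expr2 lerDl sumr_ge0// => j _.
by rewrite -expr2 sqr_ge0.
Qed.

Lemma enorm_eq0 a : enorm a = 0 -> a = 0.
Proof.
move=> a0; apply/rowP => i; rewrite mxE; apply/normr0_eq0/eqP.
by rewrite eq_le normr_ge0 andbT -a0 ler_abs_enorm.
Qed.

Lemma enormZ (t : R) a : enorm (t *: a) = `|t| * enorm a.
Proof.
by rewrite /enorm dotvZl dotvZr mulrA -expr2 sqrtrM ?sqr_ge0// sqrtr_sqr.
Qed.

Lemma enormN a : enorm (- a) = enorm a.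
Proof. by rewrite -scaleN1r enormZ normrN1 mul1r. Qed.

Lemma enormB_sqr a b : enorm (a - b) ^+ 2 =
  enorm a ^+ 2 - 2 * dotv a b + enorm b ^+ 2.
Proof.
rewrite !enorm_sqr dotvDl !dotvDr !dotvNl !dotvNr (dotvC b a).
by ring.
Qed.

Lemma dotv_le a b : dotv a b <= enorm a * enorm b.
Proof.
have [/enorm_eq0 ->|b0] := eqVneq (enorm b) 0.
  by rewrite dotv0r enorm0 mulr0.
have [/enorm_eq0 ->|a0] := eqVneq (enorm a) 0.
  by rewrite dotvC dotv0r enorm0 mul0r.
have A0 : 0 < enorm a by rewrite lt_neqAle eq_sym a0 enorm_ge0.
have B0 : 0 < enorm b by rewrite lt_neqAle eq_sym b0 enorm_ge0.
have := sqr_ge0 (enorm (enorm b *: a - enorm a *: b)).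
rewrite enormB_sqr dotvZl dotvZr !enormZ !ger0_norm ?enorm_ge0// => H.
have : 0 <= (2 * enorm a * enorm b) * (enorm a * enorm b - dotv a b) by lra.
by rewrite pmulr_rge0 ?subr_ge0// !mulr_gt0.
Qed.

Lemma ler_abs_dotv a b : `|dotv a b| <= enorm a * enorm b.
Proof. by rewrite ler_norml lerNl -dotvNl -(enormN a) dotv_le enormN dotv_le. Qed.

Lemma ler_enormD a b : enorm (a + b) <= enorm a + enorm b.
Proof.
rewrite -(@ler_pXn2r _ 2) ?nnegrE ?addr_ge0 ?enorm_ge0//.
rewrite -[in enorm (a + b)](opprK b) enormB_sqr dotvNr enormN.
have := dotv_le a b.
set x := enorm a; set y := enorm b; set z := dotv a b => H.
nra.
Qed.

End euclidean.

Lemma convex_exprD {R : realType} (a b : R) (m : nat) : 0 <= a -> 0 <= b ->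
  (a + b) ^+ m.+1 <= 2 ^+ m * (a ^+ m.+1 + b ^+ m.+1).
Proof.
move=> a0 b0; elim: m => [|m IH]; first by rewrite !expr1 expr0 mul1r.
rewrite exprS (@le_trans _ _ ((a + b) * (2 ^+ m * (a ^+ m.+1 + b ^+ m.+1))))//.
  by rewrite ler_wpM2l// addr_ge0.
(* Chebyshev's inequality for two terms: this product is 2(a^(m+2) + b^(m+2)) - (a + b)(a^(m+1) +
   b^(m+1)). *)
have H : 0 <= (a ^+ m.+1 - b ^+ m.+1) * (a - b).
  have [ab|/ltW ab] := leP a b.
    by rewrite -mulrNN mulr_ge0// oppr_ge0 subr_le0// lerXn2r.
  by rewrite mulr_ge0// subr_ge0// lerXn2r.
rewrite mulrCA (exprSr 2 m) -mulrA ler_wpM2l ?exprn_ge0//.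
rewrite !(exprS _ m.+1); set x := a ^+ m.+1 in H *; set y := b ^+ m.+1 in H *.
lra.
Qed.

Section projection.
Context {R : realType} {d : nat} (A : set 'rV[R]_d) (p : 'rV[R]_d -> 'rV[R]_d).
Hypotheses (cA : is_convex_set A) (pA : is_projection A p).

(** Otherwise a small move from [p y] towards [w], which stays in [A] by convexity, would come
    closer to [y]. *)
Lemma projection_obtuse y w : A w -> dotv (y - p y) (w - p y) <= 0.
Proof.
move=> Aw; have [Ap minp] := pA y.
rewrite leNgt; apply/negP => c0.
set c := dotv _ _ in c0; pose N := enorm (w - p y) ^+ 2.
have N0 : 0 <= N by exact: sqr_ge0.
(* Minimality at parameter t gives 2c <= tN, while this t lies in (0, 1] and satisfies tN <= c. *)
pose t := c / (c + N).
have t01 : 0 < t <= 1.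
  by rewrite divr_gt0 ?ltr_wpDr//= ler_pdivrMr ?ltr_wpDr// mul1r lerDl.
have := minp (t *: w + (1 - t) *: p y).
have /[swap]/[apply] : A (t *: w + (1 - t) *: p y).
  by apply: cA => //; case/andP: t01 => /ltW -> ->.
have -> : y - (t *: w + (1 - t) *: p y) = (y - p y) - t *: (w - p y).
  by apply/rowP => i; rewrite !mxE; ring.
rewrite -(@ler_pXn2r _ 2) ?nnegrE ?enorm_ge0// (enormB_sqr (y - p y)) dotvZr enormZ exprMn.
rewrite real_normK ?num_real// -/c -/N => H.
have : t * (2 * c) <= t * (t * N) by lra.
case/andP: t01 => t0 t1; rewrite ler_pM2l// => H2.
have : t * N <= c by rewrite /t mulrAC ler_pdivrMr ?ltr_wpDr// ler_wpM2l ?(ltW c0)// lerDr ltW.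
lra.
Qed.

(** The two obtuse angle inequalities add up to |p y - p z|^2 <= <y - z, p y - p z>; Cauchy-Schwarz
    does the rest. *)
Lemma projection_nonexpansive y z : enorm (p y - p z) <= enorm (y - z).
Proof.
have [Ay _] := pA y; have [Az _] := pA z.
have H1 := projection_obtuse y Az; have H2 := projection_obtuse z Ay.
have H : enorm (p y - p z) ^+ 2 <= dotv (y - z) (p y - p z).
  rewrite enorm_sqr.
  have -> : dotv (y - z) (p y - p z) = dotv (p y - p z) (p y - p z)
     - dotv (y - p y) (p z - p y) - dotv (z - p z) (p y - p z).
    rewrite -(opprB (p y) (p z)) dotvNr opprK -dotvDl -dotvNl -dotvDl.
    by congr dotv; apply/rowP => i; rewrite !mxE; ring.
  lra.
have := le_trans H (dotv_le _ _).
have [-> _|p0] := eqVneq (enorm (p y - p z)) 0; first exact: enorm_ge0.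
by rewrite expr2 ler_pM2r// lt_neqAle eq_sym p0 enorm_ge0.
Qed.

Lemma projection_id z : A z -> p z = z.
Proof.
move=> Az; have [_ /(_ _ Az)] := pA z.
rewrite subrr enorm0 => H; apply/esym/subr0_eq/enorm_eq0/eqP.
by rewrite eq_le H enorm_ge0.
Qed.

End projection.

Lemma dotv_row_mx {R : realType} n (s t : R) (v w : 'rV[R]_n) :
  dotv (row_mx (const_mx s : 'rV[R]_1) v : 'rV[R]_(1 + n))
       (row_mx (const_mx t : 'rV[R]_1) w : 'rV[R]_(1 + n)) = s * t + dotv v w.
Proof.
rewrite /dotv big_split_ord/= big_ord1 !row_mxEl !mxE; congr (_ + _).
by apply: eq_bigr => i _; rewrite !row_mxEr.
Qed.

Lemma row_mx_surj {R : realType} n (v : 'rV[R]_(1 + n)) :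
  v = row_mx (const_mx (v ord0 (lshift n ord0)) : 'rV[R]_1) (rsubmx v).
Proof.
rewrite -[LHS]hsubmxK; congr row_mx.
by apply/rowP => i; rewrite !mxE (ord1 i).
Qed.

Section subgradient.
Context {R : realType}.

Lemma linear_combination_row n (t s1 s2 : R) (v w : 'rV[R]_n) :
  t *: (row_mx (const_mx s1 : 'rV[R]_1) v) + (1 - t) *: (row_mx (const_mx s2) w)
  = row_mx (const_mx (t * s1 + (1 - t) * s2)) (t *: v + (1 - t) *: w).
Proof.
rewrite !scale_row_mx add_row_mx; congr row_mx.
by apply/rowP => i; rewrite !mxE.
Qed.

(* Hahn-Banach in finite dimension, adding one coordinate at a time. *)
Lemma convex_linear_minorant n (p : 'rV[R]_n -> R) : is_convex_fun p ->
  exists zeta, forall v, dotv zeta v <= p v - p 0.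
Proof.
elim: n p => [|n IH] p cp.
  exists 0 => v; rewrite dotvC dotv0r (_ : v = 0) ?subrr//.
  by apply/rowP => -[].
pose rm (t : R) (v : 'rV[R]_n) : 'rV[R]_(1 + n) := row_mx (const_mx t : 'rV[R]_1) v.
have rm0 : rm 0 0 = 0.
  by apply/rowP => i; rewrite /rm !mxE; case: splitP => j _; rewrite mxE.
have [z hz] : exists z, forall v, dotv z v <= p (rm 0 v) - p (rm 0 0).
  apply: (IH (fun v => p (rm 0 v))) => a b t t01 /=.
  have := cp (rm 0 a) (rm 0 b) t t01.
  by rewrite linear_combination_row !mulr0 addr0.
(* [S] collects the lower bounds that points with negative first coordinate impose on the new slope.
   [key] says that none of them exceeds an upper bound coming from a positive first coordinate, so
   [sup S] is admissible. *)
pose S := [set (dotv z v.2 - (p (rm (- v.1) v.2) - p 0)) / v.1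
           | v in [set v : R * 'rV[R]_n | 0 < v.1]].
have key (s t : R) (v w : 'rV[R]_n) : 0 < s -> 0 < t ->
    (dotv z v - (p (rm (- s) v) - p 0)) / s <=
    ((p (rm t w) - p 0) - dotv z w) / t.
  move=> s0 t0; have st0 : 0 < s + t by rewrite addr_gt0.
  (* The weight for which the combination of first coordinates -s and t vanishes, so that [hz]
     applies to the remaining coordinates. *)
  pose l := t / (s + t).
  have l01 : 0 <= l <= 1.
    by rewrite divr_ge0 ?(ltW s0) ?(ltW t0) ?(ltW st0)//= ler_pdivrMr// mul1r lerDr (ltW s0).
  have := cp (rm (- s) v) (rm t w) l l01.
  rewrite linear_combination_row.
  have l1 : 1 - l = s / (s + t) by rewrite /l; field; rewrite gt_eqF.
  have -> : l * (- s) + (1 - l) * t = 0.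
    by rewrite l1 /l; field; rewrite gt_eqF.
  have := hz (l *: v + (1 - l) *: w).
  rewrite dotvDr !dotvZr rm0 l1 -/(rm 0 _) => H1 H2.
  have := le_trans H1 (lerB H2 (lexx (p 0))).
  rewrite /l => {H1 H2}H.
  rewrite ler_pdivrMr// mulrAC ler_pdivlMr//.
  set P1 := p (rm (- s) v) in H *; set P2 := p (rm t w) in H *.
  set D1 := dotv z v in H *; set D2 := dotv z w in H *.
  have : (t / (s + t) * D1 + s / (s + t) * D2) * (s + t) <=
    (t / (s + t) * P1 + s / (s + t) * P2 - p 0) * (s + t) by rewrite ler_pM2r.
  have -> : (t / (s + t) * D1 + s / (s + t) * D2) * (s + t) = t * D1 + s * D2.
    by field; rewrite gt_eqF.
  have -> : (t / (s + t) * P1 + s / (s + t) * P2 - p 0) * (s + t) =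
     t * P1 + s * P2 - (s + t) * p 0 by field; rewrite gt_eqF.
  lra.
have S0 : S !=set0.
  by exists ((dotv z 0 - (p (rm (- 1) 0) - p 0)) / 1), (1, 0) => //=.
have Sub (t : R) w : 0 < t -> ubound S (((p (rm t w) - p 0) - dotv z w) / t).
  by move=> t0 _ [[s v]/= s0 <-]; exact: key.
have hS : has_sup S.
  by split => //; exists (((p (rm 1 0) - p 0) - dotv z 0) / 1); exact: Sub.
exists (rm (sup S) z) => v; pose w : 'rV[R]_n := rsubmx (v : 'rV[R]_(1 + n)).
rewrite (row_mx_surj v); set t := v _ _; rewrite -/w dotv_row_mx.
have [t0|t0|->] := ltgtP t 0.
- have : S ((dotv z w - (p (rm (- - t) w) - p 0)) / (- t)).
    by exists (- t, w) => //=; rewrite oppr_gt0.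
  move=> /(ub_le_sup hS.2); rewrite ler_pdivrMr ?oppr_gt0// opprK /rm.
  lra.
- have := ge_sup S0 (@Sub t w t0).
  rewrite ler_pdivlMr// /rm; lra.
- by rewrite mulr0 add0r -rm0; exact: hz.
Qed.

Lemma convex_subgradient d (f : 'rV[R]_d -> R) (a : 'rV[R]_d) : is_convex_fun f ->
  exists2 zeta, clarke_subdiff f a zeta &
    forall h, dotv zeta h <= f (a + h) - f a.
Proof.
move=> cf; have [|z hz] := @convex_linear_minorant d (fun h => f (a + h)).
  move=> v w t t01; have := cf (a + v) (a + w) t t01.
  suff -> : t *: (a + v) + (1 - t) *: (a + w) = a + (t *: v + (1 - t) *: w) by [].
  by apply/rowP => i; rewrite !mxE; ring.
exists z => [|h]; last by have := hz h; rewrite addr0.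
(* The base point itself witnesses the limsup: by the subgradient inequality every difference
   quotient at [a] is at least <z, v>. *)
move=> v e de e0 de0; exists a, (de / 2); split; first by rewrite subrr enorm0.
have d20 : 0 < de / 2 by rewrite divr_gt0.
split; first by rewrite d20 ltr_pdivrMr// ltr_pMr// ltr1n.
rewrite ltr_pdivlMr//; have := hz ((de / 2) *: v).
rewrite addr0 dotvZr => /(lt_le_trans _); apply.
by rewrite mulrC ltr_pM2l// ltrBlDr ltrDl.
Qed.

End subgradient.

Section growth.
Context {R : realType} {d : nat} (f : 'rV[R]_d -> R) (R1 R2 : R) (m : nat).
Hypotheses (cf : is_convex_fun f) (sf : SPB f R1 R2 m).
Let C := 2 `^ (m%:R - 1) * R1.

Lemma SPB_const_ge0 : 0 <= C.
Proof. by case: sf => ? _ _ _ _; rewrite mulr_ge0// powR_ge0. Qed.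

Lemma SPB_pow_le (a b : R) : 0 <= a -> 0 <= b ->
  R1 * (a + b) ^+ m <= C * (a ^+ m + b ^+ m).
Proof.
move=> a0 b0; case: sf => R10 _ Rm _ _.
rewrite /C; case: m Rm => [|k] Rm; first by rewrite (Rm.2 erefl) mulr0 !mul0r.
rewrite -[k.+1%:R]natr1 addrK powR_mulrn// mulrAC mulrC ler_wpM2r//.
exact: convex_exprD.
Qed.

(** The subgradient at [x] bounds the increment from below and the one at [x + h], in direction
    [- h], from above. Both points have norm at most |x| + |h|, so one SPB bound serves for both. *)
Lemma SPB_growth x h :
  `|f (x + h) - f x| <= (C * enorm x ^+ m + R2 + C * enorm h ^+ m) * enorm h.
Proof.
have [R10 R20 Rm lf bf] := sf.
have h0 := enorm_ge0 h; have x0 := enorm_ge0 x.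
have B y : enorm y <= enorm x + enorm h -> R1 * enorm y ^+ m + R2 <=
    C * enorm x ^+ m + R2 + C * enorm h ^+ m.
  move=> yxh; rewrite addrAC lerD2r -mulrDr (le_trans _ (SPB_pow_le x0 h0))//.
  by rewrite ler_wpM2l// lerXn2r ?nnegrE ?addr_ge0 ?enorm_ge0.
have [z cz hz] := convex_subgradient x cf.
have [z' cz' hz'] := convex_subgradient (x + h) cf.
rewrite ler_norml; apply/andP; split.
  rewrite lerNl; apply: (@le_trans _ _ (- dotv z h)).
    by rewrite lerN2; exact: hz.
  rewrite -dotvNl (le_trans (dotv_le _ _))// enormN ler_wpM2r//.
  by rewrite (le_trans (bf _ _ cz))// B// lerDl.
have := hz' (- h); rewrite addrK dotvNr lerNl opprB => /le_trans; apply.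
rewrite (le_trans (dotv_le _ _))// ler_wpM2r//.
by rewrite (le_trans (bf _ _ cz'))// B// ler_enormD.
Qed.

End growth.

(** * Borel structure on row vectors *)

(** An opaque identity, which gives the sigma-algebra on row vectors a display of its own. *)
Definition measure_rV_display : measure_display -> measure_display.
Proof. exact. Qed.

Section measurable_rV.
Context {R : realType} (n : nat).

Let coord : 'I_n -> 'rV[R]_n -> R := fun i v => v ord0 i.

Let rV_set0 : g_sigma_preimage coord set0.
Proof. exact: sigma_algebra0. Qed.

Let rV_setC A : g_sigma_preimage coord A -> g_sigma_preimage coord (~` A).
Proof. exact: sigma_algebraC. Qed.

Let rV_bigcup (F : _^nat) : (forall i, g_sigma_preimage coord (F i)) ->
  g_sigma_preimage coord (\bigcup_i (F i)).
Proof. exact: sigma_algebra_bigcup. Qed.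

(** The sigma-algebra generated by the coordinates: maps into row vectors are tested coordinatewise,
    and finite measures are determined on boxes. *)
HB.instance Definition _ := @isMeasurable.Build
  (measure_rV_display default_measure_display)
  'rV[R]_n (g_sigma_preimage coord) rV_set0 rV_setC rV_bigcup.

Lemma measurable_coord (i : 'I_n) :
  measurable_fun [set: 'rV[R]_n] (fun v : 'rV[R]_n => v ord0 i).
Proof.
move=> _ Y mY; rewrite setTI; apply: sub_sigma_algebra => /=.
rewrite -bigcup_seq/=; exists i => /=; first by rewrite mem_index_enum.
by exists Y => //; rewrite setTI.
Qed.

Lemma measurable_fun_rVP (d : measure_display) (T : measurableType d)
    (g : T -> 'rV[R]_n) :
  (forall i, measurable_fun setT (fun w => g w ord0 i)) <-> measurable_fun setT g.
Proof.
split=> [mg|mg i]; last first.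
  exact: (measurableT_comp (measurable_coord i) mg).
have sub : @measurable _ 'rV[R]_n `<=` [set B | measurable (g @^-1` B)].
  apply: smallest_sub; first split => /=.
  - by rewrite preimage_set0.
  - by move=> B mB; rewrite setTD preimage_setC; exact: measurableC.
  - by move=> F mF; rewrite preimage_bigcup; exact: bigcupT_measurable.
  move=> B; rewrite -bigcup_seq/= => -[i _ [C mC <-]].
  by rewrite setTI; have := mg i measurableT C mC; rewrite setTI.
by move=> _ A mA; rewrite setTI; exact: sub.
Qed.

Definition box (B : 'I_n -> set R) : set 'rV[R]_n :=
  [set v | forall i, B i (v ord0 i)].

Definition boxes : set (set 'rV[R]_n) :=
  [set box B | B in [set B | forall i, measurable (B i)]].

Lemma boxE B : box B = \big[setI/setT]_(i < n) ((fun v : 'rV[R]_n => v ord0 i) @^-1` B i).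
Proof.
apply/seteqP; split=> v /=.
  move=> Bv; apply: (big_ind (fun X : set 'rV[R]_n => X v)) => //.
  by move=> i _; exact: Bv.
by move=> H i; move: H; rewrite (bigD1 i)//= => -[].
Qed.

Lemma measurable_box B : (forall i, measurable (B i)) -> measurable (box B).
Proof.
move=> mB; rewrite boxE; apply: bigsetI_measurable => i _.
by rewrite -[X in measurable X]setTI; exact: measurable_coord.
Qed.

Lemma measurable_boxesE : @measurable _ 'rV[R]_n = <<s boxes >>.
Proof.
rewrite eqEsubset; split.
  apply: smallest_sub; first exact: smallest_sigma_algebra.
  move=> A; rewrite -bigcup_seq/= => -[i _ [C mC <-]].
  apply: sub_sigma_algebra; exists (fun j => if j == i then C else setT).
    by move=> j /=; case: ifP.
  apply/seteqP; split=> v /=.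
    by move=> /(_ i); rewrite eqxx.
  by move=> [_ Cv] j; case: eqP => [->|].
apply: smallest_sub; first exact: sigma_algebra_measurable.
by move=> _ [B mB <-]; exact: measurable_box.
Qed.

(** Boxes generate the sigma-algebra, are stable under intersection and include the whole space, so
    the uniqueness theorem for measures on a pi-system applies. *)
Lemma rV_measure_unique (m1 m2 : {measure set 'rV[R]_n -> \bar R}) :
  (m1 setT < +oo)%E ->
  (forall B, (forall i, measurable (B i)) -> m1 (box B) = m2 (box B)) ->
  forall A, measurable A -> m1 A = m2 A.
Proof.
move=> m1oo m12 A mA; apply: (measure_unique boxes (fun=> setT)) => //.
- exact: measurable_boxesE.
- move=> _ _ [B mB <-] [C mC <-]; exists (fun i => B i `&` C i).
    by move=> i; exact: measurableI.
  by apply/seteqP; split => [v H|v [Bv Cv] i]; [split => i; have [] := H i|split].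
- by move=> _; exists (fun=> setT) => //; apply/seteqP; split.
- by rewrite bigcup_const.
- by move=> _ [B mB <-]; exact: m12.
Qed.

End measurable_rV.

Section measurable_rV_ops.
Context {R : realType} (d : measure_display) (T : measurableType d) (n : nat).
Implicit Types (g h : T -> 'rV[R]_n).

Lemma measurable_rVD g h : measurable_fun setT g -> measurable_fun setT h ->
  measurable_fun setT (fun w => g w + h w).
Proof.
move=> /measurable_fun_rVP mg /measurable_fun_rVP mh; apply/measurable_fun_rVP => i.
under eq_fun do rewrite mxE.
exact: measurable_funD.
Qed.

Lemma measurable_rVZ (k : T -> R) g : measurable_fun setT k -> measurable_fun setT g ->
  measurable_fun setT (fun w => k w *: g w).
Proof.
move=> mk /measurable_fun_rVP mg; apply/measurable_fun_rVP => i.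
under eq_fun do rewrite mxE.
exact: measurable_funM.
Qed.

Lemma measurable_rVB g h : measurable_fun setT g -> measurable_fun setT h ->
  measurable_fun setT (fun w => g w - h w).
Proof.
move=> mg mh; apply: measurable_rVD => //.
under eq_fun do rewrite -scaleN1r.
exact: measurable_rVZ.
Qed.

Lemma measurable_dotv g h : measurable_fun setT g -> measurable_fun setT h ->
  measurable_fun setT (fun w => dotv (g w) (h w)).
Proof.
move=> /measurable_fun_rVP mg /measurable_fun_rVP mh.
by apply: measurable_sum => i; exact: measurable_funM.
Qed.

Lemma measurable_enorm g : measurable_fun setT g ->
  measurable_fun setT (fun w => enorm (g w)).
Proof.
move=> mg; apply: (@measurableT_comp _ _ _ _ _ _ (@Num.sqrt R)).
  exact: continuous_measurable_fun (@sqrt_continuous R).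
exact: measurable_dotv.
Qed.

Lemma measurable_row_mx p g (h : T -> 'rV[R]_p) :
  measurable_fun setT g -> measurable_fun setT h ->
  measurable_fun setT (fun w => row_mx (g w) (h w)).
Proof.
move=> /measurable_fun_rVP mg /measurable_fun_rVP mh; apply/measurable_fun_rVP => i.
under eq_fun do rewrite mxE.
by case: (fintype.split i).
Qed.

End measurable_rV_ops.

Lemma measurable_lsubmx {R : realType} p q :
  measurable_fun setT (@lsubmx R 1 p q).
Proof.
apply/measurable_fun_rVP => i; under eq_fun do rewrite mxE.
exact: measurable_coord.
Qed.

Lemma measurable_rsubmx {R : realType} p q :
  measurable_fun setT (@rsubmx R 1 p q).
Proof.
apply/measurable_fun_rVP => i; under eq_fun do rewrite mxE.
exact: measurable_coord.
Qed.

Lemma measurable_const_mx {R : realType} :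
  measurable_fun setT (fun t : R => const_mx t : 'rV[R]_1).
Proof.
apply/measurable_fun_rVP => i; under eq_fun do rewrite mxE.
exact: measurable_id.
Qed.

Section locally_lipschitz_measurable.
Context {R : realType} (n : nat).

Definition dyadic (k : nat) (v : 'rV[R]_n) : 'rV[R]_n :=
  \row_i ((Num.floor (2 ^+ k * v ord0 i))%:~R / 2 ^+ k).

Lemma enorm_dyadic k (v : 'rV[R]_n) :
  enorm (dyadic k v - v) <= Num.sqrt n%:R / 2 ^+ k.
Proof.
have k0 : 0 < 2 ^+ k :> R by rewrite exprn_gt0.
rewrite -(@ler_pXn2r _ 2) ?nnegrE ?enorm_ge0// ?divr_ge0 ?sqrtr_ge0 ?(ltW k0)//.
rewrite enorm_sqr exprMn sqr_sqrtr ?ler0n//.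
have -> : n%:R * (2 ^+ k)^-1 ^+ 2 = \sum_(i < n) (2 ^+ k)^-1 ^+ 2 :> R.
  by rewrite sumr_const card_ord mulr_natl.
apply: ler_sum => i _.
rewrite -expr2 !mxE -[leLHS]real_normK ?num_real//.
rewrite ler_pXn2r ?nnegrE ?invr_ge0 ?(ltW k0)//.
rewrite -[X in `|_ - X|](mulfK (lt0r_neq0 k0)) -mulrBl normrM normfV (gtr0_norm k0).
rewrite ler_pdivrMr// mulVf ?gt_eqF// [v _ _ * _]mulrC.
have /andP[] := floor_itv (2 ^+ k * v ord0 i).
rewrite ler_norml; lra.
Qed.

(** [dyadic k] takes countably many values, each on a box of half-open intervals, so [g] may be
    arbitrary. *)
Lemma measurable_dyadic_comp k (g : 'rV[R]_n -> R) :
  measurable_fun setT (g \o dyadic k).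
Proof.
move=> _ A mA; rewrite setTI.
pose F (v : 'rV[R]_n) : {ffun 'I_n -> int} := [ffun i => Num.floor (2 ^+ k * v ord0 i)].
pose G (z : {ffun 'I_n -> int}) : 'rV[R]_n := \row_i ((z i)%:~R / 2 ^+ k).
have FG v : dyadic k v = G (F v) by apply/rowP => i; rewrite !mxE ffunE.
have -> : (g \o dyadic k) @^-1` A =
    \bigcup_(z in [set z | A (g (G z))]) (F @^-1` [set z]).
  apply/seteqP; split=> v /=; first by rewrite FG => Av; exists (F v).
  by move=> [z Az Fv]; rewrite FG Fv.
rewrite bigcup_mkcond; apply: countable_bigcupT_measurable.
  exact: countableP.
move=> z; case: ifP => // _; have -> : F @^-1` [set z] = box (fun i =>
    [set t | Num.floor (2 ^+ k * t) = z i]).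
  apply/seteqP; split => v /=; first by move=> <- i /=; rewrite ffunE.
  by move=> H; apply/ffunP => i; rewrite ffunE; exact: H.
apply: measurable_box => i.
rewrite [X in measurable X](_ : _ =
    (fun t : R => 2 ^+ k * t) @^-1` `[(z i)%:~R, (z i + 1)%:~R[%classic).
  rewrite -[X in measurable X]setTI.
  have mf : measurable_fun setT (fun t : R => 2 ^+ k * t) by exact: measurable_funM.
  by apply: mf => //; exact: measurable_itv.
apply/seteqP; split => t /=; rewrite in_itv/=; last by move/floor_def.
by move=> <-; exact: floor_itv.
Qed.

(** The function is the pointwise limit of [g \o dyadic k], since [dyadic k v] tends to [v] in
    [enorm]. *)
Lemma locally_lipschitz_measurable (g : 'rV[R]_n -> R) :
  locally_lipschitz g -> measurable_fun setT g.
Proof.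
move=> lg; apply: (measurable_fun_cvg (h := fun k => g \o dyadic k)).
  by move=> k; exact: measurable_dyadic_comp.
move=> v _; apply/cvgrPdist_le => e e0.
have [de [L [de0 HL]]] := lg v.
have c : (fun k => Num.sqrt n%:R / 2 ^+ k : R) @ \oo --> (0 : R).
  rewrite -[X in _ --> X](mulr0 (Num.sqrt n%:R)).
  apply: cvgM; first exact: cvg_cst.
  have : (fun k => (2^-1 : R) ^+ k) @ \oo --> (0 : R).
    by apply: cvg_expr; rewrite ger0_norm ?invr_ge0// invf_lt1// ltr1n.
  by under eq_fun do rewrite exprVn.
(* The definition of [locally_lipschitz] fixes no sign for [L], hence the absolute value. *)
have c' : (fun k => `|L| * (Num.sqrt n%:R / 2 ^+ k) : R) @ \oo --> (0 : R).
  rewrite -[X in _ --> X](mulr0 `|L|).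
  by apply: cvgM => //; exact: cvg_cst.
move/cvgrPdist_lt : c => /(_ _ de0) c; move/cvgrPdist_le : c' => /(_ _ e0) c'.
near=> k.
have ck : enorm (dyadic k v - v) < de.
  apply: le_lt_trans (enorm_dyadic k v) _.
  have : `|0 - Num.sqrt n%:R / 2 ^+ k| < de by near: k.
  by rewrite sub0r normrN ger0_norm// divr_ge0.
rewrite distrC; apply: le_trans (HL _ _ ck _) _; first by rewrite subrr enorm0.
apply: (@le_trans _ _ (`|L| * (Num.sqrt n%:R / 2 ^+ k))).
  apply: (@le_trans _ _ (`|L| * enorm (dyadic k v - v))).
    by rewrite ler_wpM2r ?enorm_ge0// ler_norm.
  by rewrite ler_wpM2l// enorm_dyadic.
have : `|0 - `|L| * (Num.sqrt n%:R / 2 ^+ k)| <= e by near: k.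
by rewrite sub0r normrN ger0_norm// mulr_ge0// divr_ge0.
Unshelve. all: by end_near. Qed.

Lemma measurable_nonexpansive p (g : 'rV[R]_n -> 'rV[R]_p) :
  (forall y z, enorm (g y - g z) <= enorm (y - z)) -> measurable_fun setT g.
Proof.
move=> hg; apply/measurable_fun_rVP => i.
apply: locally_lipschitz_measurable => a; exists 1, 1; split => // y z _ _.
by have := le_trans (ler_abs_enorm (g y - g z) i) (hg y z); rewrite !mxE mul1r.
Qed.

End locally_lipschitz_measurable.

(** * The standard Gaussian measure *)

Section density.
Local Open Scope ereal_scope.
Context (d : measure_display) (T : measurableType d) (R : realType).
Variables (mu nu : {measure set T -> \bar R}) (p : T -> R).
Hypotheses (mp : measurable_fun setT p) (p0 : forall x, (0 <= p x)%R).
Hypothesis nuE : forall A, measurable A -> nu A = \int[mu]_(x in A) (p x)%:E.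

Import HBNNSimple.

Let integral_density_nnsfun (f : {nnsfun T >-> R}) :
  \int[nu]_x (f x)%:E = \int[mu]_x ((f x)%:E * (p x)%:E).
Proof.
under [LHS]eq_integral do rewrite fimfunE -fsumEFin//.
rewrite [LHS]ge0_integral_fsum//; last 2 first.
  - by move=> r; exact/measurable_EFinP/measurableT_comp.
  - by move=> n x _; rewrite EFinM nnfun_muleindic_ge0.
under [RHS]eq_integral.
  move=> x xD; rewrite fimfunE -fsumEFin// muleC ge0_mule_fsumr; last first.
    by move=> r; rewrite EFinM nnfun_muleindic_ge0.
  over.
rewrite [RHS]ge0_integral_fsum//; last 2 first.
  - move=> r; apply: emeasurable_funM; first exact/measurable_EFinP.
    exact/measurable_EFinP/measurableT_comp.
  - move=> n x _; apply: mule_ge0; first by rewrite lee_fin.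
    by rewrite EFinM nnfun_muleindic_ge0.
apply: eq_fsbigr => r _; rewrite integralZl_indic_nnsfun//= integral_indic// setIT.
(* A nonnegative simple function never takes a negative value, so both sides vanish in that case. *)
have [r0|r0] := ltP r 0%R.
  rewrite preimage_nnfun0// measure0 mule0; apply/esym.
  by under eq_integral do rewrite indic0 mulr0 mule0; rewrite integral0.
under [RHS]eq_integral do rewrite EFinM muleCA.
rewrite ge0_integralZl//; first last.
- by move=> x _; rewrite mule_ge0// lee_fin.
- by apply: emeasurable_funM; exact/measurable_EFinP.
congr (_ * _); rewrite nuE// integral_mkcond/=; apply: eq_integral => x _.
by rewrite patchE indicE; case: ifP => _; rewrite ?mule1 ?mule0.
Qed.

(** [nuE] is the case of indicators; linearity gives simple functions and monotone convergence the
    rest. *)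
Lemma ge0_integral_density (f : T -> \bar R) : measurable_fun setT f ->
  (forall x, 0 <= f x) -> \int[nu]_x f x = \int[mu]_x (f x * (p x)%:E).
Proof.
move=> mf f0; pose f_ := nnsfun_approx measurableT mf.
have f_cvg x : (f_ n x)%:E @[n --> \oo] --> f x by exact: cvg_nnsfun_approx.
transitivity (limn (fun n => \int[nu]_x (f_ n x)%:E)).
  rewrite -monotone_convergence//=.
  - by apply: eq_integral => x _; apply/esym/cvg_lim => //=.
  - by move=> n; exact/measurable_EFinP/measurable_funTS.
  - by move=> n ? _; rewrite lee_fin.
  - by move=> ? _ ? ? mn; rewrite lee_fin; exact/lefP/nd_nnsfun_approx.
transitivity (limn (fun n => \int[mu]_x ((f_ n x)%:E * (p x)%:E))).
  by apply: congr_lim; apply/funext => n /=; exact: integral_density_nnsfun.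
rewrite -monotone_convergence//=; first last.
- move=> x _ a b ab; apply: lee_wpmul2r; rewrite lee_fin//; exact/lefP/nd_nnsfun_approx.
- by move=> n x _; apply: mule_ge0; rewrite lee_fin.
- by move=> n; apply: emeasurable_funM; exact/measurable_EFinP.
by apply: eq_integral => x _; apply/cvg_lim => //; exact: cvgeZr.
Qed.

End density.

Section translation.
Context {R : realType}.
Local Notation mu := (@lebesgue_measure R).

Lemma measurable_addr (a : R) : measurable_fun setT (fun t : R => t + a).
Proof. exact: measurable_funD. Qed.

(** The image measure agrees with Lebesgue measure on half-open intervals, which determine the
    latter. *)
Lemma lebesgue_measure_translation (a : R) (A : set R) : measurable A ->
  mu ((fun t : R => t + a) @^-1` A) = mu A.
Proof.
move=> mA; apply/esym.
pose m := measure_function_pushforward__canonical__measure_function_Measure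
  mu (measurable_addr a : @measurable_fun _ _ (measurableTypeR R)
    (measurableTypeR R) setT (fun t : R => t + a)).
apply: (@lebesgue_measure_unique R m) => // _ [[x y] _ <-].
rewrite /m /= /pushforward.
rewrite [X in _ = mu X](_ : _ = `]x - a, y - a]%classic).
  rewrite !lebesgue_measure_itv/= !lte_fin ltrD2r.
  by case: ifP => // _; rewrite -!EFinB; congr EFin; ring.
apply/seteqP; split => t /=; rewrite !in_itv/= ltrBlDr lerBrDr//.
Qed.

Lemma ge0_integral_translation (a : R) (f : R -> \bar R) :
  measurable_fun setT f -> (forall x, 0 <= f x)%E ->
  (\int[mu]_t f (t + a)%R = \int[mu]_t f t)%E.
Proof.
move=> mf f0.
rewrite -(@ge0_integral_pushforward _ _ (measurableTypeR R) (measurableTypeR R) R _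
  (measurable_addr a) mu setT f)//.
apply: eq_measure_integral; first exact: measurable_addr.
by move=> ? A mA _; exact: lebesgue_measure_translation.
Qed.

End translation.

Section std_normal.
Context {R : realType}.
Local Notation N01 := (@normal_prob R 0 1).
Local Notation mu := (@lebesgue_measure R).

Lemma ge0_integral_normal (f : R -> \bar R) :
  measurable_fun setT f -> (forall x, 0 <= f x)%E ->
  (\int[N01]_t f t = \int[mu]_t (f t * (normal_pdf 0 1 t)%:E))%E.
Proof.
apply: (@ge0_integral_density _ (measurableTypeR R) R mu N01) => //.
- exact: measurable_normal_pdf.
- exact: normal_pdf_ge0.
Qed.

Lemma std_normal_pdfE (t : R) :
  normal_pdf 0 1 t = normal_peak 1 * expR (- (t ^+ 2 / 2)).
Proof.
rewrite normal_pdfE ?oner_eq0// /normal_fun subr0 expr1n mulNr.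
by rewrite -[1 *+ 2]/(2%:R).
Qed.

(** The Cameron-Martin formula on the line: the exponential is the quotient of the normal densities
    at t + a and t, and Lebesgue measure is translation invariant. *)
Lemma ge0_integral_normal_shift (a : R) (f : R -> \bar R) :
  measurable_fun setT f -> (forall x, 0 <= f x)%E ->
  (\int[N01]_t f (t - a)%R =
   \int[N01]_t (f t * (expR (- ((t : R) * a) - a ^+ 2 / 2))%:E))%E.
Proof.
move=> mf f0.
have mfa : measurable_fun setT (fun t : R => f (t - a)).
  by apply: measurableT_comp => //; exact: measurable_addr.
have me : measurable_fun setT (fun t : R => expR (- (t * a) - a ^+ 2 / 2)).
  apply: measurableT_comp => //; apply: measurable_funB => //.
  by apply: measurableT_comp => //; exact: measurable_funM.
have mfe : measurable_fun setT (fun t : R =>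
    f t * (expR (- (t * a) - a ^+ 2 / 2))%:E)%E.
  by apply: emeasurable_funM => //; exact/measurable_EFinP.
have fe0 t : (0 <= f t * (expR (- (t * a) - a ^+ 2 / 2))%:E)%E.
  by rewrite mule_ge0// lee_fin expR_ge0.
rewrite !ge0_integral_normal//.
rewrite -(@ge0_integral_translation _ (- a) (fun t =>
    f t * (expR (- (t * a) - a ^+ 2 / 2))%:E * (normal_pdf 0 1 t)%:E)%E).
- apply: eq_integral => t _; rewrite -[RHS]muleA; congr (_ * _)%E.
  rewrite -EFinM !std_normal_pdfE mulrCA -expRD; congr (_ * expR _)%:E.
  by field.
- apply: emeasurable_funM => //; apply/measurable_EFinP.
  exact: measurable_normal_pdf.
- by move=> t; rewrite mule_ge0// lee_fin normal_pdf_ge0.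
Qed.

(** Against the normal density the integrand is v times the density of N(0, v^2) with v^2 = 1/(1 -
    2s), so the integral is v. Squared, the bound reads 1 + x <= exp x at x = 2s/(1 - 2s). The
    exponential form turns products over coordinates into a factor n in the exponent. *)
Lemma normal_mgf_sqr (s : R) : 0 <= s < 2^-1 ->
  (\int[N01]_t (expR (s * t ^+ 2))%:E <= (expR (s / (1 - 2 * s)))%:E)%E.
Proof.
move=> /andP[s0 s1].
have c0 : 0 < 1 - 2 * s by lra.
have me : measurable_fun setT (fun t : R => expR (s * t ^+ 2)).
  apply: measurableT_comp => //; apply: measurable_funM => //.
rewrite ge0_integral_normal; [|exact/measurable_EFinP|]; last first.
  by move=> t; rewrite lee_fin expR_ge0.
pose v : R := Num.sqrt (1 - 2 * s)^-1.
have v0 : 0 < v by rewrite sqrtr_gt0 invr_gt0.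
have v2 : v ^+ 2 = (1 - 2 * s)^-1 by rewrite sqr_sqrtr// invr_ge0 ltW.
rewrite (_ : (\int[mu]_t _ = \int[mu]_t (v%:E * (normal_pdf 0 v t)%:E))%E); last first.
  apply: eq_integral => t _; rewrite -!EFinM; congr EFin.
  rewrite std_normal_pdfE normal_pdfE ?gt_eqF// mulrCA -expRD [RHS]mulrA; congr (_ * _).
    rewrite /normal_peak expr1n mul1r -mulrnAr sqrtrM ?sqr_ge0// sqrtr_sqr.
    by rewrite (gtr0_norm v0) invfM mulrA divff ?mul1r// gt_eqF.
  rewrite /normal_fun subr0 v2; congr expR; rewrite -(mulr_natr (1 - 2 * s)^-1) invfM invrK.
  by field.
rewrite ge0_integralZl//; first last.
- by rewrite lee_fin (ltW v0).
- by move=> t _; rewrite lee_fin normal_pdf_ge0.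
- by apply/measurable_EFinP; exact: measurable_normal_pdf.
rewrite integral_normal_pdf mule1 lee_fin.
rewrite -(@ler_pXn2r _ 2) ?nnegrE ?expR_ge0 ?(ltW v0)// v2.
rewrite -expRM_natl [leLHS](_ : _ = 1 + 2 * (s / (1 - 2 * s))).
  exact: expR_ge1Dx.
by field; rewrite gt_eqF.
Qed.

End std_normal.

Section product_probability.
Local Open Scope ereal_scope.
Context (d1 d2 : measure_display) (T1 : measurableType d1) (T2 : measurableType d2)
  (R : realType) (P1 : probability T1 R) (P2 : probability T2 R).

(** A name for the product measure that can carry the structure of a probability, as [distribution]
    requires. *)
Definition product_prob : set (T1 * T2) -> \bar R := P1 \x P2.

HB.instance Definition _ := Measure.on product_prob.

Let product_prob_setT : product_prob setT = 1.
Proof.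
rewrite /product_prob -setXTT [LHS]product_measure1E//.
exact: etrans (f_equal2 _ (probability_setT P1) (probability_setT P2)) (mule1 _).
Qed.

HB.instance Definition _ :=
  Measure_isProbability.Build _ _ R product_prob product_prob_setT.

End product_probability.

Section gauss.
Context {R : realType}.
Local Notation N01 := (@normal_prob R 0 1).

Definition cons_rV n (tv : measurableTypeR R * 'rV[R]_n) : 'rV[R]_n.+1 :=
  row_mx (const_mx (tv.1 : R) : 'rV[R]_1) tv.2 : 'rV[R]_(1 + n).

Lemma measurable_cons_rV n : measurable_fun setT (@cons_rV n).
Proof.
apply: (@measurable_row_mx R _ (measurableTypeR R * 'rV[R]_n)%type 1 n
  (fun tv => const_mx (tv.1 : R)) snd) => //.
apply: (@measurableT_comp _ _ _ _ _ _ (fun t : R => const_mx t : 'rV[R]_1)) => //.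
exact: measurable_const_mx.
Qed.

HB.instance Definition _ n := isMeasurableFun.Build _ _ _ _ (@cons_rV n)
  (@measurable_cons_rV n).

(** The recursion mirrors [gauss_expect], so that the two can be identified by peeling off one
    coordinate at a time. *)
Fixpoint gauss (n : nat) : probability 'rV[R]_n R :=
  match n with
  | 0%N => \d_(0 : 'rV[R]_0)
  | n'.+1 => distribution (product_prob N01 (gauss n')) (@cons_rV n')
  end.

Lemma measurable_fun_rV0 (g : 'rV[R]_0 -> \bar R) : measurable_fun setT g.
Proof.
have -> : g = cst (g 0) by apply/funext => v; congr g; apply/rowP => -[].
exact: measurable_cst.
Qed.

Lemma integral_gauss0 (g : 'rV[R]_0 -> \bar R) : (\int[gauss 0]_v g v)%E = g 0.
Proof.
rewrite integral_dirac//; last exact: measurable_fun_rV0.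
by rewrite diracT mul1e.
Qed.

Lemma ge0_integral_gaussS n (g : 'rV[R]_n.+1 -> \bar R) :
  measurable_fun setT g -> (forall v, 0 <= g v)%E ->
  (\int[gauss n.+1]_v g v =
   \int[N01]_t \int[gauss n]_v g (cons_rV (t, v)))%E.
Proof.
move=> mg g0; rewrite ge0_integral_distribution//.
rewrite /product_prob fubini_tonelli1//.
  exact: measurableT_comp.
by move=> x; exact: g0.
Qed.

Lemma measurable_integral_gaussS n (g : 'rV[R]_n.+1 -> \bar R) :
  measurable_fun setT g -> (forall v, 0 <= g v)%E ->
  measurable_fun setT (fun t : measurableTypeR R =>
    \int[gauss n]_v g (cons_rV (t, v)))%E.
Proof.
move=> mg g0; apply: (measurable_fun_fubini_tonelli_F (g \o @cons_rV n)) => //.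
  exact: measurableT_comp.
by move=> x; exact: g0.
Qed.

Lemma dotv_cons n (t s : R) (v w : 'rV[R]_n) :
  dotv (cons_rV (t, v)) (cons_rV (s, w)) = t * s + dotv v w.
Proof. exact: dotv_row_mx. Qed.

Lemma cons_rVB n (t s : R) (v w : 'rV[R]_n) :
  cons_rV (t, v) - cons_rV (s, w) = cons_rV ((t - s)%R, v - w).
Proof. by apply/rowP => i; rewrite !mxE; case: splitP => j _; rewrite !mxE. Qed.

Lemma cons_rVK n (v : 'rV[R]_n.+1) :
  v = cons_rV (v ord0 ord0, rsubmx (v : 'rV[R]_(1 + n))).
Proof.
rewrite /cons_rV/= (_ : ord0 = lshift n ord0 :> 'I_(1 + n)); last exact: val_inj.
exact: row_mx_surj.
Qed.

Lemma gauss_mgf_sqr n (s : R) : 0 <= s < 2^-1 ->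
  (\int[gauss n]_v (expR (s * enorm v ^+ 2))%:E <=
   (expR (n%:R * (s / (1 - 2 * s))))%:E)%E.
Proof.
move=> s01.
have me p : measurable_fun setT (fun v : 'rV[R]_p => (expR (s * enorm v ^+ 2))%:E).
  apply/measurable_EFinP; apply: measurableT_comp => //; apply: measurable_funM => //.
  by apply: measurable_funX; exact: measurable_enorm.
elim: n => [|n IH].
  by rewrite integral_gauss0 enorm0 expr0n/= mulr0 mul0r.
rewrite ge0_integral_gaussS//.
pose I := (\int[gauss n]_v (expR (s * enorm v ^+ 2))%:E)%E.
have I0 : (0 <= I)%E by apply: integral_ge0 => v _; rewrite lee_fin expR_ge0.
have met : measurable_fun setT (fun t : R => (expR (s * t ^+ 2))%:E).
  by apply/measurable_EFinP; apply: measurableT_comp => //; exact: measurable_funM.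
rewrite [leLHS](_ : _ = \int[N01]_t ((expR (s * (t : R) ^+ 2))%:E * I))%E; last first.
  apply: eq_integral => t _; rewrite -ge0_integralZl; [|by []|exact: me|
    by move=> v _; rewrite lee_fin expR_ge0|by rewrite lee_fin expR_ge0].
  apply: eq_integral => v _; rewrite -EFinM -expRD -mulrDr.
  by congr (expR (s * _))%:E; rewrite !enorm_sqr dotv_cons expr2.
rewrite ge0_integralZr; [|by []|exact: met|
  by move=> t _; rewrite lee_fin expR_ge0|by []].
rewrite -natr1 addrC mulrDl mul1r expRD EFinM lee_pmul//.
- by apply: integral_ge0 => t _; rewrite lee_fin expR_ge0.
- exact: normal_mgf_sqr.
Qed.

(** The Cameron-Martin formula in dimension n, for nonnegative functions so that Tonelli can
    separate the first coordinate. *)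
Lemma gauss_shift n (a : 'rV[R]_n) (f : 'rV[R]_n -> R) :
  measurable_fun setT f -> (forall x, 0 <= f x) ->
  (\int[gauss n]_u (f (u - a))%:E =
   \int[gauss n]_u (f u * expR (- dotv u a - enorm a ^+ 2 / 2))%:E)%E.
Proof.
elim: n a f => [|n IH] a f mf f0.
  have -> : a = 0 by apply/rowP => -[].
  rewrite !integral_gauss0 subr0 dotv0r enorm0 expr0n/=.
  by rewrite mul0r subr0 oppr0 expR0 mulr1.
have me p (b : 'rV[R]_p) : measurable_fun setT
    (fun u : 'rV[R]_p => expR (- dotv u b - enorm b ^+ 2 / 2)).
  apply: measurableT_comp => //; apply: measurable_funB => //.
  by apply: measurableT_comp => //; exact: measurable_dotv.
have mc (t : measurableTypeR R) : measurable_fun setT (fun v : 'rV[R]_n => f (cons_rV (t, v))).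
  exact: (measurableT_comp mf (measurableT_comp (@measurable_cons_rV n) (pair1_measurable t))).
rewrite (cons_rVK a); set a0 := a _ _; set a' := rsubmx _.
rewrite ge0_integral_gaussS//; first last.
- by move=> v; rewrite lee_fin.
- apply/measurable_EFinP; apply: measurableT_comp => //.
  exact: measurable_rVB.
rewrite ge0_integral_gaussS//; first last.
- by move=> v; rewrite lee_fin mulr_ge0// expR_ge0.
- apply/measurable_EFinP; exact: (measurable_funM mf (me _ _)).
(* [h] absorbs the likelihood ratio of the last n coordinates: induction shifts those inside, and
   the formula on the line then shifts the first one. *)
pose h (u : 'rV[R]_n.+1) : R := f u *
  expR (- dotv (rsubmx (u : 'rV[R]_(1 + n))) a' - enorm a' ^+ 2 / 2).
have mh : measurable_fun setT h.
  apply: measurable_funM => //.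
  by apply: (@measurableT_comp _ _ _ _ _ _ _ _ (@rsubmx R 1 1 n) (me n a'));
    exact: measurable_rsubmx.
have h0 u : 0 <= h u by rewrite mulr_ge0// expR_ge0.
have hE t v : h (cons_rV (t, v)) = f (cons_rV (t, v)) *
    expR (- dotv v a' - enorm a' ^+ 2 / 2).
  by rewrite /h /cons_rV row_mxKr.
pose G (t : R) := (\int[gauss n]_v (h (cons_rV (t, v)))%:E)%E.
have mG : measurable_fun setT G.
  apply: (measurable_integral_gaussS (g := fun v => (h v)%:E)) => //.
  exact/measurable_EFinP.
have G0 t : (0 <= G t)%E by apply: integral_ge0 => v _; rewrite lee_fin.
transitivity (\int[N01]_t G (t - a0)%R)%E.
  apply: eq_integral => t _; rewrite /G.
  under [RHS]eq_integral do rewrite hE.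
  by rewrite -IH//; apply: eq_integral => v _; rewrite cons_rVB.
rewrite ge0_integral_normal_shift//; apply: eq_integral => t _.
have mht : measurable_fun setT (fun v : 'rV[R]_n => (h (cons_rV (t, v)))%:E).
  apply/measurable_EFinP; under eq_fun do rewrite hE.
  exact: (measurable_funM (mc t) (me _ _)).
rewrite /G -ge0_integralZr; [|by []|by []|
  by move=> v _; rewrite lee_fin|by rewrite lee_fin expR_ge0].
apply: eq_integral => v _; rewrite hE -EFinM -mulrA -expRD; congr (_ * expR _)%:E.
rewrite !enorm_sqr !dotv_cons.
by field.
Qed.

Lemma gauss_box n (B : 'I_n -> set R) : (forall i, measurable (B i)) ->
  gauss n (box B) = (\prod_(i < n) N01 (B i))%E.
Proof.
elim: n B => [|n IH] B mB.
  rewrite big_ord0 /= diracE (_ : _ \in _)//.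
  by rewrite inE => -[].
rewrite big_ord_recl -IH//= /distribution /pushforward /product_prob.
rewrite -[RHS]product_measure1E; [|exact: mB|exact: measurable_box].
congr (product_measure1 _ _ _); apply/seteqP; split => -[t v] /=.
  move=> H; split => /=.
    have := H ord0; rewrite mxE.
    by case: splitP => // i _; rewrite mxE.
  move=> i; have := H (lift ord0 i); rewrite mxE.
  case: splitP => [j /= ji|j /= ji]; last by rewrite (_ : j = i)//; apply/val_inj; case: ji.
  by have := ltn_ord j; rewrite -ji.
move=> [/= Bt Bv] i; rewrite mxE; case: splitP => [j /= ij|j /= ij].
  by rewrite mxE (_ : i = ord0)//; apply/val_inj; rewrite /= ij (ord1 j).
by rewrite (_ : i = lift ord0 j); [exact: Bv|exact: val_inj].
Qed.

Lemma gauss_unique n (Q : probability 'rV[R]_n R) :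
  (forall B, (forall i, measurable (B i)) ->
    Q (box B) = (\prod_(i < n) N01 (B i))%E) ->
  forall A, measurable A -> Q A = gauss n A.
Proof.
move=> QB; apply: rV_measure_unique; first exact: fin_num_fun_lty.
by move=> B mB; exact: etrans (QB _ mB) (esym (gauss_box mB)).
Qed.

Definition cat_rV p q (vw : 'rV[R]_p * 'rV[R]_q) : 'rV[R]_(p + q) :=
  row_mx vw.1 vw.2.

Lemma measurable_cat_rV p q : measurable_fun setT (@cat_rV p q).
Proof. exact: (measurable_row_mx measurable_fst measurable_snd). Qed.

HB.instance Definition _ p q := isMeasurableFun.Build _ _ _ _ (@cat_rV p q)
  (@measurable_cat_rV p q).

Lemma measurable_integral_gaussD p q (g : 'rV[R]_(p + q) -> \bar R) :
  measurable_fun setT g -> (forall v, 0 <= g v)%E ->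
  measurable_fun setT (fun w => \int[gauss p]_v g (row_mx v w))%E.
Proof.
move=> mg g0; apply: (measurable_fun_fubini_tonelli_G (g \o @cat_rV p q)) => //.
  exact: measurableT_comp.
by move=> x; exact: g0.
Qed.

(** The product of the two Gaussian measures has the right mass on boxes. In the process the inner
    block is the fresh noise and the outer block the past. *)
Lemma ge0_integral_gaussD p q (g : 'rV[R]_(p + q) -> \bar R) :
  measurable_fun setT g -> (forall v, 0 <= g v)%E ->
  (\int[gauss (p + q)]_v g v =
   \int[gauss q]_w \int[gauss p]_v g (row_mx v w))%E.
Proof.
move=> mg g0; pose Q := distribution (product_prob (gauss p) (gauss q)) (@cat_rV p q).
transitivity (\int[Q]_v g v)%E.
  apply: eq_measure_integral => A mA _; apply/esym; apply: gauss_unique => // B mB.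
  rewrite big_split_ord/= -(@gauss_box p (fun i => B (lshift q i)))//.
  rewrite -(@gauss_box q (fun i => B (rshift p i)))//.
  rewrite /Q /distribution /pushforward /product_prob.
  rewrite -[RHS]product_measure1E; [|exact: measurable_box|exact: measurable_box].
  congr (product_measure1 _ _ _); apply/seteqP; split => -[v w] /=.
    move=> H; split => i.
      by have := H (lshift q i); rewrite /cat_rV row_mxEl.
    by have := H (rshift p i); rewrite /cat_rV row_mxEr.
  move=> [/= Hv Hw] i; rewrite /cat_rV/= mxE.
  by case: splitP => j ij; [rewrite (_ : i = lshift q j)|rewrite (_ : i = rshift p j)];
    rewrite //; exact: val_inj.
rewrite ge0_integral_distribution// /product_prob fubini_tonelli2//.
  exact: measurableT_comp.
by move=> x; exact: g0.
Qed.

End gauss.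

(** * Functions of subgaussian growth *)

Section subgauss.
Context {R : realType} {n : nat}.
Implicit Types (h g : 'rV[R]_n -> R).

(** Asking for every rate s, not just one, is what makes the class stable: products spend s/2 on
    each factor, and translations also work at rate s/2. *)
Definition subgauss h := measurable_fun setT h /\
  forall s : R, 0 < s -> exists C, forall u, `|h u| <= C * expR (s * enorm u ^+ 2).

Lemma subgauss_le h g : measurable_fun setT h -> subgauss g ->
  (forall u, `|h u| <= `|g u|) -> subgauss h.
Proof.
move=> mh [mg Bg] hg; split => // s s0; have [C HC] := Bg s s0.
by exists C => u; exact: le_trans (hg u) (HC u).
Qed.

Lemma subgaussD h g : subgauss h -> subgauss g -> subgauss (fun u => h u + g u).
Proof.
move=> [mh Bh] [mg Bg]; split => [|s s0]; first exact: measurable_funD.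
have [C HC] := Bh s s0; have [C' HC'] := Bg s s0; exists (C + C') => u.
by rewrite mulrDl (le_trans (ler_normD _ _))// lerD.
Qed.

Lemma subgaussM h g : subgauss h -> subgauss g -> subgauss (fun u => h u * g u).
Proof.
move=> [mh Bh] [mg Bg]; split => [|s s0]; first exact: measurable_funM.
have s20 : 0 < s / 2 by rewrite divr_gt0.
have [C HC] := Bh _ s20; have [C' HC'] := Bg _ s20; exists (C * C') => u.
have -> : s * enorm u ^+ 2 = s / 2 * enorm u ^+ 2 + s / 2 * enorm u ^+ 2 by field.
by rewrite expRD mulrACA normrM ler_pM.
Qed.

Lemma subgauss_cst (c : R) : subgauss (fun=> c).
Proof.
split => // s s0; exists `|c| => u.
by rewrite ler_peMr// -expR0 ler_expR mulr_ge0 ?sqr_ge0// (ltW s0).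
Qed.

Lemma subgaussZ (c : R) h : subgauss h -> subgauss (fun u => c * h u).
Proof. by move=> sh; apply: subgaussM => //; exact: subgauss_cst. Qed.

Lemma subgaussN h : subgauss h -> subgauss (fun u => - h u).
Proof.
by move=> sh; apply: (@subgauss_le _ h) => // [|u];
  [apply: measurableT_comp => //; case: sh|rewrite normrN].
Qed.

Lemma subgaussB h g : subgauss h -> subgauss g -> subgauss (fun u => h u - g u).
Proof. by move=> sh sg; apply: subgaussD => //; exact: subgaussN. Qed.

Lemma subgauss_norm h : subgauss h -> subgauss (fun u => `|h u|).
Proof.
by move=> sh; apply: (@subgauss_le _ h) => // [|u];
  [apply: measurableT_comp => //; case: sh|rewrite normr_id].
Qed.

Lemma subgaussX h k : subgauss h -> subgauss (fun u => h u ^+ k).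
Proof.
move=> sh; elim: k => [|k IH]; first exact: subgauss_cst.
by under eq_fun do rewrite exprS; exact: subgaussM.
Qed.

Lemma subgauss_exp_enorm (c : R) : subgauss (fun u => expR (c * enorm u)).
Proof.
split => [|s s0].
  apply: measurableT_comp => //; apply: measurable_funM => //.
  exact: measurable_enorm.
(* The constant comes from completing the square in s e^2 - c e. *)
exists (expR (c ^+ 2 / (4 * s))) => u; rewrite ger0_norm ?expR_ge0//.
rewrite -expRD ler_expR; set e := enorm u.
have := sqr_ge0 (s * e - c / 2).
have -> : (s * e - c / 2) ^+ 2 = s * (c ^+ 2 / (4 * s) + s * e ^+ 2 - c * e).
  by field; rewrite gt_eqF.
by rewrite pmulr_rge0// subr_ge0.
Qed.

Lemma subgauss_enorm : subgauss (fun u => enorm u).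
Proof.
apply: (subgauss_le _ (subgauss_exp_enorm 1)) => [|u]; first exact: measurable_enorm.
rewrite !ger0_norm ?expR_ge0 ?enorm_ge0// mul1r.
by apply: le_trans (expR_ge1Dx _); rewrite lerDr.
Qed.

Lemma subgauss_dotv (a : 'rV[R]_n) : subgauss (fun u => dotv u a).
Proof.
apply: (subgauss_le _ (subgaussZ (enorm a) subgauss_enorm)) => [|u].
  exact: measurable_dotv.
by rewrite [leRHS]ger0_norm ?mulr_ge0 ?enorm_ge0// mulrC ler_abs_dotv.
Qed.

Lemma subgauss_shift (a : 'rV[R]_n) h : subgauss h -> subgauss (fun u => h (u - a)).
Proof.
move=> [mh Bh]; split => [|s s0].
  by apply: measurableT_comp => //; exact: measurable_rVB.
have s20 : 0 < s / 2 by rewrite divr_gt0.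
(* Half the rate suffices because |u - a|^2 <= 2|a|^2 + 2|u|^2. *)
have [C HC] := Bh _ s20; exists (C * expR (s * enorm a ^+ 2)) => u.
have C0 : 0 <= C.
  have := HC 0; rewrite enorm0 expr0n/= mulr0 expR0 mulr1; exact: le_trans.
apply: (le_trans (HC _)); rewrite -[leRHS]mulrA -expRD ler_wpM2l// ler_expR.
have H : enorm (u - a) ^+ 2 <= 2 * enorm a ^+ 2 + 2 * enorm u ^+ 2.
  rewrite enormB_sqr; have := sqr_ge0 (enorm (u + a)).
  rewrite -[in enorm (u + a)](opprK a) enormB_sqr enormN dotvNr; lra.
have : s / 2 * enorm (u - a) ^+ 2 <= s / 2 * (2 * enorm a ^+ 2 + 2 * enorm u ^+ 2).
  by rewrite ler_pM2l.
lra.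
Qed.

Lemma subgauss_integrable h : subgauss h -> (gauss n).-integrable setT (EFin \o h).
Proof.
move=> [mh Bh]; have [//|C HC] := Bh 4^-1.
have me : measurable_fun setT (fun u : 'rV[R]_n => (expR (4^-1 * enorm u ^+ 2))%:E).
  apply/measurable_EFinP; apply: measurableT_comp => //; apply: measurable_funM => //.
  by apply: measurable_funX; exact: measurable_enorm.
have C0 : 0 <= C.
  have := HC 0; rewrite enorm0 expr0n/= mulr0 expR0 mulr1; exact: le_trans.
apply/integrableP; split; first exact/measurable_EFinP.
apply: (@le_lt_trans _ _ (\int[gauss n]_u (C%:E * (expR (4^-1 * enorm u ^+ 2))%:E)))%E.
  apply: ge0_le_integral => //.
  - by apply: measurableT_comp => //; exact/measurable_EFinP.
  - by apply: emeasurable_funM.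
  - by move=> u _; rewrite -EFinM lee_fin.
rewrite ge0_integralZl; [|by []|exact: me|by move=> u _; rewrite lee_fin expR_ge0|
  by rewrite lee_fin].
have s4 : 0 <= (4^-1 : R) < 2^-1 by lra.
apply: (@le_lt_trans _ _ (C%:E * (expR (n%:R * (4^-1 / (1 - 2 * 4^-1))))%:E)%E).
  by rewrite lee_wpmul2l ?lee_fin// gauss_mgf_sqr.
by rewrite -EFinM ltry.
Qed.

Definition gE h : R := Rintegral (gauss n) setT h.

Lemma gE_EFin h : subgauss h -> (\int[gauss n]_u (h u)%:E = (gE h)%:E)%E.
Proof.
by move=> /subgauss_integrable ih; rewrite fineK//; exact: integrable_fin_num.
Qed.

Lemma gED h g : subgauss h -> subgauss g -> gE (fun u => h u + g u) = gE h + gE g.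
Proof. by move=> /subgauss_integrable ? /subgauss_integrable ?; exact: RintegralD. Qed.

Lemma gEB h g : subgauss h -> subgauss g -> gE (fun u => h u - g u) = gE h - gE g.
Proof. by move=> /subgauss_integrable ? /subgauss_integrable ?; exact: RintegralB. Qed.

Lemma gEZ c h : subgauss h -> gE (fun u => c * h u) = c * gE h.
Proof. by move=> /subgauss_integrable ?; exact: RintegralZl. Qed.

Lemma gE_cst c : gE (fun=> c) = c.
Proof.
rewrite /gE Rintegral_cst//.
have e := @probability_setT _ _ _ (@gauss R n).
exact: etrans (congr1 (fun x => c * fine x) e) (mulr1 c).
Qed.

Lemma gE_le h g : subgauss h -> subgauss g -> (forall u, h u <= g u) -> gE h <= gE g.
Proof.
move=> /subgauss_integrable ? /subgauss_integrable ? hg.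
by apply: le_Rintegral => // u _; exact: hg.
Qed.

Lemma gE_eq h g : (forall u, h u = g u) -> gE h = gE g.
Proof. by move=> /funext ->. Qed.

Lemma gE_shift (a : 'rV[R]_n) h : subgauss h ->
  subgauss (fun u => h u * expR (- dotv u a - enorm a ^+ 2 / 2)) /\
  gE (fun u => h (u - a)) = gE (fun u => h u * expR (- dotv u a - enorm a ^+ 2 / 2)).
Proof.
move=> sh.
have se : subgauss (fun u => expR (- dotv u a - enorm a ^+ 2 / 2)).
  apply: (subgauss_le _ (subgauss_exp_enorm (enorm a))) => [|u].
    apply: measurableT_comp => //; apply: measurable_funB => //.
    by apply: measurableT_comp => //; exact: measurable_dotv.
  rewrite !ger0_norm ?expR_ge0// ler_expR lerBlDr.
  apply: (@le_trans _ _ (enorm a * enorm u)).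
    by rewrite -dotvNl (le_trans (dotv_le _ _))// enormN mulrC.
  by rewrite lerDl divr_ge0// sqr_ge0.
split; first exact: subgaussM.
have pos g : subgauss g -> (forall u, 0 <= g u) -> gE (fun u => g (u - a)) =
    gE (fun u => g u * expR (- dotv u a - enorm a ^+ 2 / 2)).
  by move=> [mg _] g0; congr fine; exact: gauss_shift.
have sn := subgauss_norm sh.
(* [pos] covers nonnegative functions only; it is applied to h + |h| and to |h|, and the second
   identity is cancelled from the first. *)
have sum0 u : 0 <= h u + `|h u|.
  by have := ler_norm (- h u); rewrite normrN; lra.
have L : gE (fun u => h (u - a) + `|h (u - a)|) =
    gE (fun u => h (u - a)) + gE (fun u => `|h (u - a)|).
  by rewrite gED; [|exact: subgauss_shift|exact: (subgauss_shift a sn)].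
have := pos _ (subgaussD sh sn) sum0; rewrite L (pos _ sn)//.
under [X in _ = gE X]eq_fun do rewrite mulrDl.
rewrite gED; [|exact: subgaussM|exact: subgaussM].
exact: addIr.
Qed.

End subgauss.

Lemma subgauss_cons {R : realType} n (h : 'rV[R]_n.+1 -> R) (t : R) :
  subgauss h -> subgauss (fun v : 'rV[R]_n => h (cons_rV (t, v))).
Proof.
move=> [mh Bh]; split => [|s s0].
  exact: (measurableT_comp mh (measurableT_comp (@measurable_cons_rV R n)
    (@pair1_measurable _ _ (measurableTypeR R) _ t))).
have [C HC] := Bh s s0; exists (C * expR (s * t ^+ 2)) => v.
rewrite -[leRHS]mulrA -expRD -mulrDr.
by have := HC (cons_rV (t, v)); rewrite !enorm_sqr dotv_cons expr2.
Qed.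

(** The iterated integral is over signed functions, so Fubini is applied; [subgauss] supplies
    integrability and passes to the sections. *)
Lemma gauss_expectE {R : realType} n (h : 'rV[R]_n -> R) : subgauss h ->
  (gauss_expect (fun u => (h u)%:E) = (gE h)%:E)%E.
Proof.
move=> sh; rewrite -gE_EFin//; elim: n h sh => [|n IH] h sh.
  by rewrite integral_gauss0.
have mh : measurable_fun setT (EFin \o h) by apply/measurable_EFinP; case: sh.
rewrite /gauss_expect -/gauss_expect.
have ih : (product_prob (@normal_prob R 0 1) (gauss n)).-integrable setT
    ((EFin \o h) \o @cons_rV R n).
  apply/integrableP; split; first exact: measurableT_comp.
  have /integrableP[_] := subgauss_integrable sh.
  rewrite ge0_integral_distribution//; exact: measurableT_comp.
transitivity (\int[@normal_prob R 0 1]_t \int[gauss n]_v (h (cons_rV (t, v)))%:E)%E.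
  by apply: eq_integral => t _; rewrite -IH//; exact: subgauss_cons.
rewrite [RHS]integral_distribution//.
exact: (integral12_prod_meas1 (f := (EFin \o h) \o @cons_rV R n)).
Qed.

(** * Gradient inequality and moments *)

Section gaussian_gradient.
Context {R : realType} {n : nat}.

(** Only the quadratic order matters, so the constant is 1 instead of 1/2 and everything follows
    from 1 + x <= exp x. *)
Lemma expR_taylor1 (r : R) : `|expR r - 1 - r| <= r ^+ 2 * expR `|r|.
Proof.
have H1 (x : R) : expR x - 1 <= x * expR x.
  have := expR_ge1Dx (- x); rewrite -(ler_pM2r (expR_gt0 x)) -expRD addNr expR0.
  lra.
have H2 : `|expR r - 1| <= `|r| * expR `|r|.
  have [r0|r0] := leP 0 r.
    by rewrite !ger0_norm// subr_ge0 -expR0 ler_expR.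
  rewrite (ltr0_norm r0) ltr0_norm; last by rewrite subr_lt0 -expR0 ltr_expR.
  have := expR_ge1Dx r; have e1 : 1 <= expR (- r) by rewrite -expR0 ler_expR oppr_ge0 ltW.
  have : - r <= - r * expR (- r) by rewrite ler_peMr// oppr_ge0 ltW.
  lra.
have p0 : 0 <= expR r - 1 - r by have := expR_ge1Dx r; lra.
rewrite ger0_norm//; apply: (@le_trans _ _ (r * (expR r - 1))).
  by have := H1 r; lra.
apply: (le_trans (ler_norm _)); rewrite normrM.
apply: (@le_trans _ _ (`|r| * (`|r| * expR `|r|))); first by rewrite ler_wpM2l.
by rewrite mulrA -expr2 real_normK ?num_real.
Qed.

(** Replaces the passage to the limit as t tends to 0. *)
Lemma le_of_forall_small (x y K : R) :
  (forall t : R, 0 < t <= 1 -> x <= y + t * K) -> x <= y.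
Proof.
move=> H; rewrite leNgt; apply/negP => yx.
(* At t/2 the error is at most (x - y)/2, half of the gap to be excluded. *)
pose t := (x - y) / (x - y + `|K|).
have xy0 : 0 < x - y by rewrite subr_gt0.
have D0 : 0 < x - y + `|K| by rewrite ltr_wpDr.
have t01 : 0 < t <= 1.
  by rewrite divr_gt0//= ler_pdivrMr// mul1r lerDl.
have t2 : 0 < t / 2 <= 1.
  by case/andP: t01 => ? ?; apply/andP; split; lra.
have := H _ t2.
have : t / 2 * K <= (x - y) / 2.
  rewrite mulrAC ler_pM2r ?invr_gt0//.
  apply: (@le_trans _ _ (t * `|K|)).
    by case/andP: t01 => t0 _; rewrite ler_pM2l// ler_norm.
  by rewrite /t mulrAC ler_pdivrMr// ler_pM2l// lerDr ltW.
lra.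
Qed.

(* Shifting by t * a produces the likelihood ratio exp(-t <u,a> - t^2|a|^2/2),
   whose first-order expansion in t is compared with convexity of h along the
   segment from u to u - a. *)
Lemma gauss_gradient_ineq (h : 'rV[R]_n -> R) (a : 'rV[R]_n) :
  is_convex_fun h -> subgauss h ->
  gE h - gE (fun u => h (u - a)) <= gE (fun u => h u * dotv u a).
Proof.
move=> ch sh.
pose rho (u : 'rV[R]_n) := enorm a * enorm u + enorm a ^+ 2 / 2.
have srho : subgauss rho.
  apply: subgaussD; last exact: subgauss_cst.
  by apply: subgaussZ; exact: subgauss_enorm.
have serho : subgauss (fun u => expR (rho u)).
  under eq_fun do rewrite /rho expRD.
  by apply: subgaussM; [exact: subgauss_exp_enorm|exact: subgauss_cst].
have rho0 u : 0 <= rho u by rewrite addr_ge0 ?mulr_ge0 ?divr_ge0 ?sqr_ge0 ?enorm_ge0.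
(* [K] dominates the second-order remainder: for 0 < t <= 1 the exponent r of the likelihood ratio
   satisfies |r| <= t rho, whence |h (exp r - 1 - r)| <= t^2 K. *)
pose K u := `|h u| * (rho u ^+ 2 * expR (rho u)).
have sK : subgauss K.
  apply: subgaussM; first exact: subgauss_norm.
  by apply: subgaussM => //; exact: subgaussX.
have sd := subgaussM sh (subgauss_dotv a).
have sha := subgauss_shift a sh.
apply: (@le_of_forall_small _ _ (enorm a ^+ 2 / 2 * gE h + gE K)) => t /andP[t0 t1].
have [ss] := gE_shift (t *: a) sh.
have up : gE (fun u => h (u - t *: a)) <= (1 - t) * gE h + t * gE (fun u => h (u - a)).
  rewrite -!gEZ// -gED; [|exact: subgaussZ|exact: subgaussZ].
  apply: gE_le => [||u]; first exact: subgauss_shift.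
    by apply: subgaussD; exact: subgaussZ.
  have := ch (u - a) u t; rewrite (ltW t0) t1 => /(_ isT).
  have -> : t *: (u - a) + (1 - t) *: u = u - t *: a.
    by apply/rowP => i; rewrite !mxE; ring.
  lra.
have lo : gE h - t * gE (fun u => h u * dotv u a) - t ^+ 2 * (enorm a ^+ 2 / 2 * gE h + gE K)
    <= gE (fun u => h u * expR (- dotv u (t *: a) - enorm (t *: a) ^+ 2 / 2)).
  rewrite -gEZ// -gEZ// -gED//; last exact: subgaussZ.
  rewrite -gEZ//; last by apply: subgaussD => //; exact: subgaussZ.
  rewrite -gEB//; last exact: subgaussZ.
  have s2 : subgauss (fun u => t ^+ 2 * (enorm a ^+ 2 / 2 * h u + K u)).
    by apply: subgaussZ; apply: subgaussD => //; exact: subgaussZ.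
  have s1 : subgauss (fun u => h u - t * (h u * dotv u a)).
    by apply: subgaussB => //; exact: subgaussZ.
  rewrite -gEB//; apply: gE_le => //; first exact: subgaussB.
  move=> u; rewrite dotvZr enormZ exprMn real_normK ?num_real//.
  set r := - (t * dotv u a) - _.
  have rr : `|r| <= t * rho u.
    rewrite /r (le_trans (ler_normB _ _))// normrN normrM (gtr0_norm t0) mulrDr lerD//.
      by rewrite ler_pM2l// mulrC ler_abs_dotv.
    rewrite ger0_norm; last by rewrite divr_ge0// mulr_ge0// sqr_ge0.
    rewrite mulrA ler_pM2r ?invr_gt0// ler_wpM2r ?sqr_ge0//.
    by rewrite expr2 ler_piMr// ltW.
  have e1 := expR_taylor1 r.
  have e2 : r ^+ 2 * expR `|r| <= t ^+ 2 * (rho u ^+ 2 * expR (rho u)).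
    rewrite mulrA -exprMn; apply: ler_pM.
    - exact: sqr_ge0.
    - exact: expR_ge0.
    - by rewrite -[r ^+ 2]real_normK ?num_real// lerXn2r ?nnegrE// mulr_ge0// ltW.
    - by rewrite ler_expR (le_trans rr)// ler_piMl.
  have e3 : - (`|h u| * `|expR r - 1 - r|) <= h u * (expR r - 1 - r).
    by rewrite -normrM lerNl -[leRHS]normrN ler_norm.
  have e4 : `|h u| * `|expR r - 1 - r| <= t ^+ 2 * K u.
    rewrite /K mulrCA ler_wpM2l// (le_trans e1)//.
  have e5 : h u * r = - (t * (h u * dotv u a)) - t ^+ 2 * (enorm a ^+ 2 / 2 * h u).
    by rewrite /r; ring.
  move: e3 e4; rewrite mulrBr mulrBr e5 mulr1; lra.
move=> eqs; move: up; rewrite eqs => up.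
have := le_trans lo up.
set A := gE h; set B := gE (fun u => h u * dotv u a); set C := gE (fun u => h (u - a)).
set Q := _ + gE K => H.
have : t * (A - C) <= t * (B + t * Q) by lra.
by rewrite ler_pM2l.
Qed.

(** For the constant function 1 the gradient inequality reads 0 <= E<u, b>; it is used at [a] and at
    [- a]. *)
Lemma gE_dotv (a : 'rV[R]_n) : gE (fun u => dotv u a) = 0.
Proof.
have H (b : 'rV[R]_n) : 0 <= gE (fun u => dotv u b).
  have := @gauss_gradient_ineq (fun=> 1) b.
  rewrite !gE_cst subrr (gE_eq (g := fun u => dotv u b)).
    by apply; [move=> ? ? t _; lra|exact: subgauss_cst].
  by move=> u; rewrite mul1r.
apply/eqP; rewrite eq_le H andbT -oppr_ge0 -[leRHS]mulN1r -gEZ; last exact: subgauss_dotv.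
by rewrite (gE_eq (g := fun u => dotv u (- a)))// => u; rewrite dotvNr mulN1r.
Qed.

End gaussian_gradient.

Section gaussian_moments.
Context {R : realType} {d : nat}.

Lemma enorm_rV0 (u : 'rV[R]_0) : enorm u = 0.
Proof. by rewrite (_ : u = 0) ?enorm0//; apply/rowP => -[]. Qed.

(** The shift [b] keeps the 1 of 1 + x <= exp x on the left: the second moment uses b = 1, the other
    moments b = 0. *)
Lemma gE_le_exp (h : 'rV[R]_d -> R) (c s b : R) : subgauss h -> 0 <= c ->
  0 <= s < 2^-1 -> (forall u, 0 <= h u + b) ->
  (forall u, h u + b <= c * expR (s * enorm u ^+ 2)) ->
  gE h + b <= c * expR (d%:R * (s / (1 - 2 * s))).
Proof.
move=> sh c0 s01 hb0 hb.
have shb : subgauss (fun u => h u + b) by apply: subgaussD => //; exact: subgauss_cst.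
rewrite -[X in _ + X](@gE_cst R d b) -gED//; last exact: subgauss_cst.
rewrite -lee_fin -gE_EFin//.
have me : measurable_fun setT (fun u : 'rV[R]_d => (expR (s * enorm u ^+ 2))%:E).
  apply/measurable_EFinP; apply: measurableT_comp => //; apply: measurable_funM => //.
  by apply: measurable_funX; exact: measurable_enorm.
apply: (@le_trans _ _ (\int[gauss d]_u (c%:E * (expR (s * enorm u ^+ 2))%:E)))%E.
  apply: ge0_le_integral => //.
  - by move=> u _; rewrite lee_fin.
  - by apply/measurable_EFinP; case: shb.
  - exact: emeasurable_funM.
  - by move=> u _; rewrite -EFinM lee_fin.
rewrite ge0_integralZl; [|by []|exact: me|by move=> u _; rewrite lee_fin expR_ge0|
  by rewrite lee_fin].
by rewrite EFinM lee_wpmul2l ?lee_fin// gauss_mgf_sqr.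
Qed.

(* Optimising y^q <= (q/s)^q exp(s y - q) over s: at s = q/(2q+d) the bound on
   the Laplace transform of |u|^2 cancels exp(-q). *)
Lemma gE_enorm_powR (p : nat) : (0 < p)%N ->
  gE (fun u : 'rV[R]_d => enorm u ^+ p) <= (p + d)%N%:R `^ (p%:R / 2).
Proof.
move=> p0.
(* In dimension 0 the chosen s would be 1/2, outside the range of the Laplace bound; there |u| = 0
   and p > 0. *)
case: (posnP d) => [d0|d0].
  subst d; rewrite (gE_eq (g := fun=> 0)) ?gE_cst ?powR_ge0// => u.
  by rewrite enorm_rV0 expr0n gtn_eqF.
pose q : R := p%:R / 2; pose D : R := (p + d)%N%:R; pose s := q / D.
have q0 : 0 < q by rewrite divr_gt0// ltr0n.
have dR : 0 < d%:R :> R by rewrite ltr0n.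
have DE : D = 2 * q + d%:R by rewrite /D natrD /q; field.
have D0 : 0 < D by rewrite DE addr_gt0// mulr_gt0.
have s0 : 0 < s by rewrite divr_gt0.
have s01 : 0 <= s < 2^-1.
  by rewrite (ltW s0)/= ltr_pdivrMr// DE; lra.
have := @gE_le_exp (fun u => enorm u ^+ p) (D `^ q * expR (- q)) s 0.
rewrite addr0 => /(_ (subgaussX p subgauss_enorm)).
have -> : d%:R * (s / (1 - 2 * s)) = q.
  have -> : 1 - 2 * s = d%:R / D by rewrite /s DE; field; rewrite -DE gt_eqF.
  by rewrite /s; field; rewrite -natrD -/D (gt_eqF D0) (gt_eqF dR).
have -> : D `^ q * expR (- q) * expR q = D `^ q.
  by rewrite -mulrA -expRD addNr expR0 mulr1.
apply => //.
- by rewrite mulr_ge0 ?powR_ge0 ?expR_ge0.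
- by move=> u; rewrite addr0 exprn_ge0// enorm_ge0.
move=> u; rewrite addr0; have [->|u0] := eqVneq (enorm u) 0.
  by rewrite expr0n gtn_eqF//= !mulr_ge0 ?powR_ge0 ?expR_ge0.
have e0 : 0 < enorm u by rewrite lt_neqAle eq_sym u0 enorm_ge0.
have -> : enorm u ^+ p = (enorm u ^+ 2) `^ q.
  by rewrite -!powR_mulrn ?enorm_ge0// -powRrM; congr (_ `^ _); rewrite /q; field.
rewrite -mulrA -expRD /powR !gt_eqF ?exprn_gt0// -expRD ler_expR.
set y := enorm u ^+ 2; have y0 : 0 < y by rewrite exprn_gt0.
have H : ln (y / D) <= y / D - 1.
  have := expR_ge1Dx (ln (y / D)); rewrite lnK ?posrE ?divr_gt0//; lra.
rewrite lnM ?posrE ?invr_gt0// lnV ?posrE// in H.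
have := ler_wpM2l (ltW q0) H; rewrite mulrDr mulrN mulrBr mulr1 /s.
have -> : q / D * y = q * (y / D) by ring.
lra.
Qed.

(** [gE_enorm_powR] would only give 2 + d, whereas the factor sqrt d in M needs the exact value d.
    It comes from 1 + s E|u|^2 <= E exp(s|u|^2) <= exp(d s/(1 - 2s)), whose first order in s is
    E|u|^2 <= d. *)
Lemma gE_enorm_sqr : gE (fun u : 'rV[R]_d => enorm u ^+ 2) <= d%:R.
Proof.
set e := gE _; rewrite leNgt; apply/negP => de.
have e0 : 0 < e by apply: le_lt_trans de; rewrite ler0n.
pose k : R := 2 + d%:R.
have k2 : 2 <= k by rewrite lerDl ler0n.
(* The exponential bounds give e(1 - s k) <= d; this s makes the left side (e + d)/2, which exceeds
   d. *)
pose s := (e - d%:R) / (2 * e * k).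
have ek0 : 0 < 2 * e * k by rewrite !mulr_gt0//; lra.
have s0 : 0 < s by rewrite divr_gt0// subr_gt0.
have sk : s * k = (e - d%:R) / (2 * e) by rewrite /s; field; rewrite !gt_eqF//; lra.
have dn : 0 <= d%:R :> R by rewrite ler0n.
have sk2 : s * k <= 2^-1 by rewrite sk ler_pdivrMr ?mulr_gt0//; lra.
have ds : s * k = 2 * s + d%:R * s by rewrite /k; ring.
have ds0 : 0 <= d%:R * s by rewrite mulr_ge0// ltW.
have s2 : s * 2 <= s * k by rewrite ler_pM2l.
have s01 : 0 <= s < 2^-1 by rewrite (ltW s0)/=; lra.
have := @gE_le_exp (fun u => s * enorm u ^+ 2) 1 s 1.
rewrite gEZ ?mul1r; last exact: subgaussX subgauss_enorm.
move=> /(_ _ _ s01) H.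
have {H} : s * e + 1 <= expR (d%:R * (s / (1 - 2 * s))).
  apply: H => //.
  - by apply: subgaussZ; exact: subgaussX subgauss_enorm.
  - by move=> u; rewrite addr_ge0// mulr_ge0 ?sqr_ge0// ltW.
  - by move=> u; rewrite mul1r addrC expR_ge1Dx.
have c0 : 0 < 1 - 2 * s by lra.
set y := d%:R * _ => H.
have yE : y * (1 - 2 * s) = d%:R * s by rewrite /y; field; rewrite gt_eqF.
have y1 : 0 < 1 - y.
  rewrite -(pmulr_lgt0 _ c0) mulrBl yE mul1r; lra.
have : (s * e + 1) * (1 - y) <= 1.
  apply: (@le_trans _ _ (expR y * expR (- y))).
    by apply: ler_pM => //; [rewrite addr_ge0// mulr_ge0// ltW|rewrite ltW|rewrite expR_ge1Dx].
  by rewrite -expRD subrr expR0.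
rewrite -(ler_pM2r c0) -mulrA mulrBl yE => {}H.
have : s * (e * (1 - s * k)) <= s * d%:R by rewrite ds; lra.
rewrite ler_pM2l// sk.
have -> : e * (1 - (e - d%:R) / (2 * e)) = (e + d%:R) / 2 by field; rewrite gt_eqF.
lra.
Qed.

(** Jensen through a tangent line: |u| <= |u|^2/(2r) + r/2, with r = sqrt d to balance the two
    terms. *)
Lemma gE_enorm : gE (fun u : 'rV[R]_d => enorm u) <= Num.sqrt d%:R.
Proof.
case: (posnP d) => [d0|d0].
  subst d; rewrite (gE_eq (g := fun=> 0)) ?gE_cst ?sqrtr_ge0// => u.
  exact: enorm_rV0.
set r := Num.sqrt _.
have r0 : 0 < r by rewrite sqrtr_gt0 ltr0n.
have rr : r * r = d%:R by rewrite -expr2 sqr_sqrtr ?ler0n.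
have s2 : subgauss (fun u : 'rV[R]_d => (2 * r)^-1 * enorm u ^+ 2).
  by apply: subgaussZ; exact: subgaussX subgauss_enorm.
apply: (@le_trans _ _ (gE (fun u : 'rV[R]_d => (2 * r)^-1 * enorm u ^+ 2 + r / 2))).
  apply: gE_le => [||u]; first exact: subgauss_enorm.
    by apply: subgaussD => //; exact: subgauss_cst.
  rewrite -(ler_pM2l (mulr_gt0 (ltr0n R 2) r0)).
  set x := enorm u; have -> : 2 * r * ((2 * r)^-1 * x ^+ 2 + r / 2) = x ^+ 2 + r ^+ 2.
    by field; rewrite gt_eqF.
  have := sqr_ge0 (x - r); lra.
rewrite gED//; last exact: subgauss_cst.
rewrite gE_cst gEZ; last exact: subgaussX subgauss_enorm.
have : (2 * r)^-1 * gE (fun u : 'rV[R]_d => enorm u ^+ 2) <= (2 * r)^-1 * d%:R.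
  by rewrite ler_pM2l ?invr_gt0 ?mulr_gt0// gE_enorm_sqr.
have -> : (2 * r)^-1 * d%:R = r / 2 by rewrite -rr; field; rewrite gt_eqF.
lra.
Qed.

End gaussian_moments.

(** * Gaussian smoothing and the one-step estimate *)

Section smoothing.
Context {R : realType} {d : nat} (f : 'rV[R]_d -> R) (R1 R2 sigma : R) (m : nat).
Hypotheses (cf : is_convex_fun f) (sf : SPB f R1 R2 m) (sigma0 : 0 < sigma).
Implicit Types (y z u : 'rV[R]_d).
Let C := 2 `^ (m%:R - 1) * R1.

Definition smooth y : R := gE (fun u => f (y + sigma *: u)).

Definition grad_est y u : 'rV[R]_d := (sigma^-1 * (f (y + sigma *: u) - f y)) *: u.

Lemma SPB_measurable : measurable_fun setT f.
Proof. by case: sf => _ _ _ lf _; exact: locally_lipschitz_measurable. Qed.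

Lemma SPB_increment y u : `|f (y + sigma *: u) - f y| <=
  (C * enorm y ^+ m + R2 + C * sigma ^+ m * enorm u ^+ m) * (sigma * enorm u).
Proof.
apply: (le_trans (SPB_growth cf sf _ _)).
by rewrite enormZ (gtr0_norm sigma0) exprMn -/C -[C * _ * _]mulrA.
Qed.

Lemma subgauss_increment y : subgauss (fun u => f (y + sigma *: u) - f y).
Proof.
have se := @subgauss_enorm R d.
apply: (@subgauss_le _ _ _ (fun u =>
  (C * enorm y ^+ m + R2 + C * sigma ^+ m * enorm u ^+ m) * (sigma * enorm u))).
- apply: measurable_funB => //; apply: measurableT_comp; first exact: SPB_measurable.
  by apply: measurable_rVD => //; exact: measurable_rVZ.
- apply: subgaussM; last exact: subgaussZ.
  by apply: subgaussD; [exact: subgauss_cst|apply: subgaussZ; exact: subgaussX].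
- by move=> u; apply: le_trans (ler_norm _); exact: SPB_increment.
Qed.

Lemma subgauss_translate y : subgauss (fun u => f (y + sigma *: u)).
Proof.
rewrite (_ : (fun _ => _) = (fun u => f (y + sigma *: u) - f y + f y)); last first.
  by apply/funext => u; rewrite subrK.
by apply: subgaussD; [exact: subgauss_increment|exact: subgauss_cst].
Qed.

Lemma gauss_smoothE y : gauss_smooth f sigma y = (smooth y)%:E.
Proof. exact: gauss_expectE (subgauss_translate y). Qed.

(** Jensen: the supporting affine function at [y] has Gaussian mean [f y], its linear part being
    centred. *)
Lemma smooth_ge y : f y <= smooth y.
Proof.
have [z _ hz] := convex_subgradient y cf.
have sd := subgaussZ sigma (subgauss_dotv z).
have -> : f y = gE (fun u => f y + sigma * dotv u z).
  rewrite gED//; last exact: subgauss_cst.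
  by rewrite gE_cst gEZ ?gE_dotv ?mulr0 ?addr0//; exact: subgauss_dotv.
apply: gE_le => [||u]; last 1 first.
- by have := hz (sigma *: u); rewrite dotvZr dotvC; lra.
- by apply: subgaussD => //; exact: subgauss_cst.
- exact: subgauss_translate.
Qed.

(** Integrating [SPB_increment] produces the moments of |u| of order 1 and m + 1, which give the two
    terms of M. *)
Lemma smooth_le y : smooth y <= f y + ((C * enorm y ^+ m + R2) * Num.sqrt d%:R
  + C * sigma ^+ m * ((m + 1 + d)%N%:R `^ ((m + 1)%N%:R / 2))) * sigma.
Proof.
have C0 : 0 <= C := SPB_const_ge0 sf.
have [_ R20 _ _ _] := sf.
have se := @subgauss_enorm R d.
pose B := C * enorm y ^+ m + R2.
have B0 : 0 <= B by rewrite addr_ge0 ?(ltW R20)// mulr_ge0// exprn_ge0// enorm_ge0.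
have s1 : subgauss (fun u => B * enorm u) by exact: subgaussZ.
have s2 : subgauss (fun u => (C * sigma ^+ m) * enorm u ^+ (m + 1)).
  by apply: subgaussZ; exact: subgaussX.
have s12 := subgaussZ sigma (subgaussD s1 s2).
apply: (@le_trans _ _ (gE (fun u => f y +
    sigma * (B * enorm u + (C * sigma ^+ m) * enorm u ^+ (m + 1))))).
  apply: gE_le => [||u]; first exact: subgauss_translate.
    by apply: subgaussD => //; exact: subgauss_cst.
  have := le_trans (ler_norm _) (SPB_increment y u); rewrite addn1 exprSr -/B.
  set c := C * sigma ^+ m; set e := enorm u; set em := e ^+ m; lra.
rewrite gED//; last exact: subgauss_cst.
rewrite gE_cst lerD2l gEZ; last exact: subgaussD.
rewrite mulrC ler_pM2r// gED// !gEZ//; last exact: subgaussX.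
rewrite lerD// ler_wpM2l// ?gE_enorm//; first by rewrite mulr_ge0// exprn_ge0// ltW.
by apply: gE_enorm_powR; rewrite addn1.
Qed.

Let H2 := 3 * Num.max
      (2 `^ (2 * (m%:R - 1)) * R1 ^+ 2 * (4 + d%:R) ^+ 2)
      (R2 ^+ 2 * (4 + d%:R) ^+ 2
        + 2 `^ (2 * (m%:R - 1)) * R1 ^+ 2 * sigma ^+ (2 * m) * ((2 * m + 4 + d)%N%:R) ^+ (m + 2)).

Lemma gE_enorm_even (k : nat) : (0 < k)%N ->
  gE (fun u => enorm u ^+ (2 * k)) <= (2 * k + d)%N%:R ^+ k.
Proof.
move=> k0; apply: (le_trans (gE_enorm_powR _)); first by rewrite muln_gt0.
by rewrite natrM mulrAC divff ?mul1r ?powR_mulrn// pnatr_eq0.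
Qed.

Lemma enorm_grad_est y u : enorm (grad_est y u) <=
  (C * enorm y ^+ m + R2 + C * sigma ^+ m * enorm u ^+ m) * enorm u ^+ 2.
Proof.
rewrite /grad_est enormZ normrM (gtr0_norm (_ : 0 < sigma^-1)) ?invr_gt0//.
have := SPB_increment y u.
set B := _ + R2 + _; set I := `|_| => H.
rewrite expr2 mulrA ler_wpM2r ?enorm_ge0// mulrC ler_pdivrMr//; lra.
Qed.

Lemma subgauss_dotv_grad_est y w : subgauss (fun u => dotv w (grad_est y u)).
Proof.
rewrite /grad_est; under eq_fun do rewrite dotvZr dotvC -mulrA.
apply: subgaussZ; apply: subgaussM; first exact: subgauss_increment.
exact: subgauss_dotv.
Qed.

Lemma subgauss_grad_est_sqr y : subgauss (fun u => enorm (grad_est y u) ^+ 2).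
Proof.
rewrite /grad_est; under eq_fun do rewrite enormZ exprMn real_normK ?num_real// exprMn.
apply: subgaussM; last exact: subgaussX subgauss_enorm.
by apply: subgaussZ; apply: subgaussX; exact: subgauss_increment.
Qed.

(** The 3 comes from (a + b + c)^2 <= 3(a^2 + b^2 + c^2); (4 + d)^2 and (2m + 4 + d)^(m + 2) bound
    the moments of order 4 and 2m + 4. The arguments of the maximum are the coefficient of N^2 and
    the constant term, and N^2 + 1 <= (N + 1)^2. *)
Lemma gE_grad_est_sqr y :
  gE (fun u => enorm (grad_est y u) ^+ 2) <= H2 * (enorm y ^+ m + 1) ^+ 2.
Proof.
have C0 : 0 <= C := SPB_const_ge0 sf.
have [_ R20 _ _ _] := sf.
have se := @subgauss_enorm R d.
set N := enorm y ^+ m.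
have N0 : 0 <= N by rewrite exprn_ge0// enorm_ge0.
have sm0 : 0 <= sigma ^+ m by rewrite exprn_ge0// ltW.
have s4 : subgauss (fun u => (3 * (C ^+ 2 * N ^+ 2 + R2 ^+ 2)) * enorm u ^+ (2 * 2)).
  by apply: subgaussZ; exact: subgaussX.
have s5 : subgauss (fun u => (3 * (C * sigma ^+ m) ^+ 2) * enorm u ^+ (2 * (m + 2))).
  by apply: subgaussZ; exact: subgaussX.
apply: (@le_trans _ _ (gE (fun u => (3 * (C ^+ 2 * N ^+ 2 + R2 ^+ 2)) * enorm u ^+ (2 * 2)
   + (3 * (C * sigma ^+ m) ^+ 2) * enorm u ^+ (2 * (m + 2))))).
  apply: gE_le => [||u]; first exact: subgauss_grad_est_sqr.
    exact: subgaussD.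
  have e0 := enorm_ge0 u.
  have em0 : 0 <= enorm u ^+ m by exact: exprn_ge0.
  apply: (@le_trans _ _ (((C * N + R2 + C * sigma ^+ m * enorm u ^+ m) * enorm u ^+ 2) ^+ 2)).
    apply: lerXn2r; rewrite ?nnegrE; [exact: enorm_ge0| |exact: enorm_grad_est].
    apply: mulr_ge0; last exact: sqr_ge0.
    have ce : 0 <= C * sigma ^+ m * enorm u ^+ m.
      exact: mulr_ge0 (mulr_ge0 C0 sm0) em0.
    have cn : 0 <= C * N by exact: mulr_ge0.
    lra.
  rewrite mulnDr exprD (mulnC 2 m) exprM exprM.
  set c := C * sigma ^+ m; set em := enorm u ^+ m; set e2 := enorm u ^+ 2.
  (* The three squared differences sum to 3(a^2 + b^2 + c^2) - (a + b + c)^2. *)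
  have : 0 <= e2 ^+ 2 * ((C * N - R2) ^+ 2 + (C * N - c * em) ^+ 2 + (R2 - c * em) ^+ 2).
    by rewrite mulr_ge0 ?sqr_ge0// !addr_ge0 ?sqr_ge0.
  lra.
rewrite gED// !gEZ//; [|exact: subgaussX|exact: subgaussX].
have m4 := @gE_enorm_even 2 isT.
have m2 : (0 < m + 2)%N by rewrite addn2.
have mm := gE_enorm_even m2.
rewrite (_ : (2 * 2 + d)%N%:R = 4 + d%:R :> R) in m4; last by rewrite natrD.
rewrite (_ : (2 * (m + 2) + d)%N = (2 * m + 4 + d)%N) in mm; last by rewrite mulnDr.
have CE : 2 `^ (2 * (m%:R - 1)) * R1 ^+ 2 = C ^+ 2.
  by rewrite /C exprMn [2 * _]mulrC powRrM powR_mulrn ?powR_ge0.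
rewrite /H2 CE.
set A := (4 + d%:R) ^+ 2 in m4 *; set G := _ ^+ (m + 2) in mm *.
have sE : sigma ^+ (2 * m) = (sigma ^+ m) ^+ 2 by rewrite mulnC exprM.
set X1 := C ^+ 2 * A; set X2 := R2 ^+ 2 * A + _.
have A0 : 0 <= A by exact: sqr_ge0.
have X10 : 0 <= X1 by rewrite mulr_ge0 ?sqr_ge0.
have l1 : X1 <= Num.max X1 X2 by rewrite le_max lexx.
have l2 : X2 <= Num.max X1 X2 by rewrite le_max lexx orbT.
set Mx := Num.max X1 X2 in l1 l2 *.
have Mx0 : 0 <= Mx := le_trans X10 l1.
have b1 := ler_wpM2l (_ : 0 <= 3 * (C ^+ 2 * N ^+ 2 + R2 ^+ 2)) m4.
have b2 := ler_wpM2l (_ : 0 <= 3 * (C * sigma ^+ m) ^+ 2) mm.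
apply: (@le_trans _ _ (3 * (X1 * N ^+ 2 + X2))).
  apply: (le_trans (lerD (b1 _) (b2 _))).
  - apply: mulr_ge0 => //; apply: addr_ge0; last exact: sqr_ge0.
    exact: mulr_ge0 (sqr_ge0 _) (sqr_ge0 _).
  - by apply: mulr_ge0 => //; exact: sqr_ge0.
  by rewrite le_eqVlt; apply/orP; left; apply/eqP; rewrite /X1 /X2 sE; ring.
have p1 : X1 * N ^+ 2 <= Mx * N ^+ 2 by rewrite ler_wpM2r ?sqr_ge0.
have p2 : 0 <= Mx * N by rewrite mulr_ge0.
have -> : 3 * Mx * (N + 1) ^+ 2 = 3 * (Mx * N ^+ 2 + Mx + 2 * (Mx * N)) by ring.
lra.
Qed.

(** In the variable u, the shift by a = (y - z)/sigma moves the centre from [y] to [z]. The term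
    [f y] subtracted in the estimator contributes nothing, since E<u, a> = 0. *)
Lemma gE_dotv_grad_est y z :
  smooth y - smooth z <= gE (fun u => dotv (y - z) (grad_est y u)).
Proof.
pose a := sigma^-1 *: (y - z).
have sn0 : sigma != 0 by rewrite gt_eqF.
have ch : is_convex_fun (fun u => f (y + sigma *: u)).
  move=> u w t t01; have := cf (y + sigma *: u) (y + sigma *: w) t01.
  suff -> : t *: (y + sigma *: u) + (1 - t) *: (y + sigma *: w) =
    y + sigma *: (t *: u + (1 - t) *: w) by [].
  by apply/rowP => i; rewrite !mxE; ring.
have := gauss_gradient_ineq a ch (subgauss_translate y).
rewrite -/(smooth y) (gE_eq (h := fun u => f (y + sigma *: (u - a)))
  (g := fun u => f (z + sigma *: u))); last first.
  move=> u; congr f; rewrite /a; apply/rowP => i; rewrite !mxE.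
  by field.
rewrite -/(smooth z) => /le_trans; apply.
have sd := subgauss_dotv a.
rewrite [leRHS](_ : _ = gE (fun u => f (y + sigma *: u) * dotv u a - f y * dotv u a)).
  rewrite gEB; [|by apply: subgaussM => //; exact: subgauss_translate|exact: subgaussZ].
  by rewrite gEZ// gE_dotv mulr0 subr0.
apply: gE_eq => u; rewrite /grad_est /a !dotvZr dotvC; ring.
Qed.

Variables (A : set 'rV[R]_d) (p : 'rV[R]_d -> 'rV[R]_d).
Hypotheses (cA : is_convex_set A) (pA : is_projection A p).

Lemma measurable_projection : measurable_fun setT p.
Proof.
by apply: measurable_nonexpansive => y z; exact: (projection_nonexpansive cA pA).
Qed.

Definition gd_step (tau : R) y u :=
  p (y - (tau / (enorm y ^+ m + 1)) *: grad_est y u).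

(** The left side stays an extended integral of a nonnegative function, the form in which Tonelli
    delivers it along the process. *)
Lemma one_step (tau : R) y z : 0 < tau -> A z ->
  (\int[gauss d]_u (enorm (gd_step tau y u - z) ^+ 2)%:E <=
   (enorm (y - z) ^+ 2 - 2 * (tau / (enorm y ^+ m + 1)) * (smooth y - smooth z)
    + H2 * tau ^+ 2)%:E)%E.
Proof.
move=> tau0 Az; set D := enorm y ^+ m + 1; set k := tau / D.
have D0 : 0 < D by rewrite ltr_wpDl// exprn_ge0// enorm_ge0.
have k0 : 0 < k by rewrite divr_gt0.
have s1 := subgauss_dotv_grad_est y (y - z).
have s2 := subgauss_grad_est_sqr y.
have s3 : subgauss (fun u => enorm (y - z) ^+ 2 - (2 * k) * dotv (y - z) (grad_est y u)).
  by apply: subgaussB; [exact: subgauss_cst|exact: subgaussZ].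
have s4 : subgauss (fun u => enorm (y - z) ^+ 2 - (2 * k) * dotv (y - z) (grad_est y u)
    + k ^+ 2 * enorm (grad_est y u) ^+ 2).
  by apply: subgaussD => //; exact: subgaussZ.
have bnd u : enorm (gd_step tau y u - z) ^+ 2 <= enorm (y - z) ^+ 2
    - (2 * k) * dotv (y - z) (grad_est y u) + k ^+ 2 * enorm (grad_est y u) ^+ 2.
  rewrite /gd_step -/D -/k -{1}(projection_id pA Az).
  apply: (@le_trans _ _ (enorm ((y - z) - k *: grad_est y u) ^+ 2)).
    rewrite lerXn2r ?nnegrE ?enorm_ge0//.
    apply: (le_trans (projection_nonexpansive cA pA _ _)).
    by rewrite addrAC.
  by rewrite (enormB_sqr (y - z)) dotvZr enormZ (gtr0_norm k0); lra.
have mg : measurable_fun setT (grad_est y).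
  apply: measurable_rVZ => //; apply: measurable_funM => //.
  by case: (subgauss_increment y).
have mn : measurable_fun setT (fun u => enorm (gd_step tau y u - z) ^+ 2).
  apply: measurable_funX; apply: measurable_enorm; apply: measurable_rVB => //.
  apply: (measurableT_comp measurable_projection).
  by apply: measurable_rVB => //; exact: measurable_rVZ.
apply: (@le_trans _ _ (\int[gauss d]_u (enorm (y - z) ^+ 2
    - (2 * k) * dotv (y - z) (grad_est y u) + k ^+ 2 * enorm (grad_est y u) ^+ 2)%:E)%E).
  apply: ge0_le_integral => //.
  - by move=> u _; rewrite lee_fin sqr_ge0.
  - exact/measurable_EFinP.
  - by apply/measurable_EFinP; case: s4.
  - by move=> u _; rewrite lee_fin.
rewrite gE_EFin// lee_fin gED//; last exact: subgaussZ.
rewrite gEB//; [|exact: subgauss_cst|exact: subgaussZ].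
rewrite gE_cst !gEZ// lerD//.
  rewrite lerD2l lerN2 ler_wpM2l//; last exact: gE_dotv_grad_est.
  by rewrite mulr_ge0// (ltW k0).
apply: (@le_trans _ _ (k ^+ 2 * (H2 * D ^+ 2))).
  by rewrite ler_wpM2l ?sqr_ge0// gE_grad_est_sqr.
(* The purpose of the normalised step: k D = tau cancels the growth of the second moment in y. *)
have -> : k ^+ 2 * (H2 * D ^+ 2) = H2 * (k * D) ^+ 2 by ring.
by rewrite /k divfK ?gt_eqF.
Qed.

End smoothing.

(** * The iterates as functions of the noise *)

Section independent_law.
Context {R : realType} (d0 : measure_display) (T : measurableType d0)
  (P : probability T R) (I : eqType) (X : I -> T -> R).
Hypotheses (mX : forall i, measurable_fun setT (X i))
  (iX : mutually_independent P X) (nX : forall i, std_normal_law P (X i)).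

(** Independence computes the law of the vector on boxes, and [gauss_unique] identifies it. *)
Lemma ge0_integral_independent_normal n (e : 'I_n -> I) (g : 'rV[R]_n -> \bar R) :
  injective e -> measurable_fun setT g -> (forall v, 0 <= g v)%E ->
  (\int[P]_w g (\row_j X (e j) w) = \int[gauss n]_v g v)%E.
Proof.
move=> ie mg g0.
pose V w : 'rV[R]_n := \row_j X (e j) w.
have mV : measurable_fun setT V.
  apply/measurable_fun_rVP => i; under eq_fun do rewrite mxE.
  exact: mX.
pose Vm : {mfun T >-> 'rV[R]_n} := HB.pack V (isMeasurableFun.Build _ _ _ _ V mV).
transitivity (\int[distribution P Vm]_v g v)%E.
  by rewrite ge0_integral_distribution.
apply: eq_measure_integral => A mA _; apply: gauss_unique => // B mB.
(* Independence quantifies over families on all of I, so indices outside the range of [e] receive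
   the whole line. *)
pose A' i := if [pick j | e j == i] is Some j then B j else setT.
have A'E j : A' (e j) = B j.
  rewrite /A'; case: pickP => [k /eqP/ie -> //|/(_ j)].
  by rewrite eqxx.
have mA' i : measurable (A' i) by rewrite /A'; case: pickP.
have := iX (s := map e (index_enum 'I_n)) (A := A').
rewrite (map_inj_uniq ie) index_enum_uniq => /(_ isT mA').
rewrite (big_map e xpredT (fun i => X i @^-1` A' i)).
rewrite (big_map e xpredT (fun i => P (X i @^-1` A' i))).
under [X in _ = X -> _]eq_bigr do rewrite A'E nX//.
move=> <-; rewrite /distribution /pushforward boxE; congr (P _).
rewrite (big_morph (fun Y => Vm @^-1` Y) (preimage_setI Vm) (preimage_setT Vm)).
by apply: eq_bigr => j _; rewrite A'E; apply/seteqP; split => w /=; rewrite /V mxE.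
Qed.

End independent_law.

Section history.
Context {R : realType} (d : nat).

Definition ord0_elim (S : Type) (j : 'I_0) : S.
Proof. by case: j. Defined.

(* Coordinates of the concatenated noise (u^{k-1}, ..., u^0), latest first. *)
Fixpoint hist_idx (k : nat) : 'I_(k * d) -> nat * 'I_d :=
  match k with
  | 0%N => fun j => ord0_elim (nat * 'I_d) j
  | k'.+1 => fun j : 'I_(d + k' * d) =>
      match fintype.split j with inl i => (k', i) | inr j' => hist_idx j' end
  end.

Lemma hist_idx_lt k (j : 'I_(k * d)) : ((hist_idx j).1 < k)%N.
Proof.
elim: k j => [|k IH] j; first by case: (j).
rewrite /=; case: splitP => [//|j' _]; exact: ltnW (IH j').
Qed.

Lemma hist_idx_inj k : injective (@hist_idx k).
Proof.
elim: k => [|k IH] i j; first by case: (i).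
rewrite /=; case: splitP => [i' ei|i' ei]; case: splitP => [j' ej|j' ej].
- by move=> [ij]; apply: val_inj; rewrite /= ei ej ij.
- by move=> H; have := hist_idx_lt j'; rewrite -H ltnn.
- by move=> H; have := hist_idx_lt i'; rewrite H ltnn.
- by move=> /IH ij; apply: val_inj; rewrite /= ei ej ij.
Qed.

Variables (T : Type) (u : nat -> 'I_d -> T -> R).

Definition history k (w : T) : 'rV[R]_(k * d) :=
  \row_j u (hist_idx j).1 (hist_idx j).2 w.

Lemma lsubmx_history k w :
  lsubmx (history k.+1 w : 'rV[R]_(d + k * d)) = \row_i u k i w.
Proof.
apply/rowP => i; rewrite !mxE /=; case: splitP => [j /= ij|j /= ij].
  by rewrite (_ : j = i)//; exact: val_inj.
by have := ltn_ord i; rewrite ij ltnNge leq_addr.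
Qed.

Lemma rsubmx_history k w :
  rsubmx (history k.+1 w : 'rV[R]_(d + k * d)) = history k w.
Proof.
apply/rowP => i; rewrite !mxE /=; case: splitP => [j /= ij|j /= /addnI ij].
  by have := ltn_ord j; rewrite -ij ltnNge leq_addr.
by rewrite (_ : j = i)//; exact: val_inj.
Qed.

End history.

Section iterates.
Context {R : realType} {d : nat} (f : 'rV[R]_d -> R) (R1 R2 sigma : R) (m : nat).
Hypotheses (cf : is_convex_fun f) (sf : SPB f R1 R2 m) (sigma0 : 0 < sigma).
Variables (A : set 'rV[R]_d) (p : 'rV[R]_d -> 'rV[R]_d) (x0 : 'rV[R]_d).
Hypotheses (cA : is_convex_set A) (pA : is_projection A p) (Ax0 : A x0).
Variable (tau : nat -> R).

Local Notation next := (gd_step f sigma m p).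

(** The newest noise is the left block and the past the right one, matching the order of
    [hist_idx]. *)
Fixpoint iterate (k : nat) : 'rV[R]_(k * d) -> 'rV[R]_d :=
  match k with
  | 0%N => fun=> x0
  | k'.+1 => fun w : 'rV[R]_(d + k' * d) =>
      next (tau k') (iterate (rsubmx w)) (lsubmx w)
  end.

Lemma iterate_in k w : A (@iterate k w).
Proof. by case: k w => [|k] w //=; rewrite /gd_step; exact: (pA _).1. Qed.

Lemma measurable_inv_weight (d1 : measure_display) (S : measurableType d1)
    (y : S -> 'rV[R]_d) : measurable_fun setT y ->
  measurable_fun setT (fun s => (enorm (y s) ^+ m + 1)^-1).
Proof.
move=> my.
(* The base is positive, so the inverse is a real power, whose measurability is available. *)
have -> : (fun s => (enorm (y s) ^+ m + 1)^-1) = (fun s => (enorm (y s) ^+ m + 1) `^ (-1)).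
  by apply/funext => s; rewrite powR_inv1// addr_ge0// exprn_ge0// enorm_ge0.
apply: (@measurableT_comp _ _ _ _ _ _ (fun t : R => t `^ (-1))).
  exact: measurable_powR.
by apply: measurable_funD => //; apply: measurable_funX; exact: measurable_enorm.
Qed.

Lemma measurable_iterate k : measurable_fun setT (@iterate k).
Proof.
elim: k => [|k IH]; first exact: measurable_cst.
have ml : measurable_fun setT (fun w : 'rV[R]_(d + k * d) => lsubmx w).
  exact: measurable_lsubmx.
have mi : measurable_fun setT (fun w : 'rV[R]_(d + k * d) => @iterate k (rsubmx w)).
  by apply: (measurableT_comp IH); exact: measurable_rsubmx.
have mf := SPB_measurable sf.
apply: (measurableT_comp (measurable_projection cA pA)).
apply: measurable_rVB => //; apply: measurable_rVZ.
  by apply: measurable_funM => //; exact: measurable_inv_weight.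
apply: measurable_rVZ => //; apply: measurable_funM => //; apply: measurable_funB.
  apply: (measurableT_comp mf); apply: measurable_rVD => //.
  exact: measurable_rVZ.
exact: measurableT_comp.
Qed.

End iterates.

(** * Expectations along the process *)

Section process.
Context {R : realType} {d : nat} (f : 'rV[R]_d -> R) (R1 R2 sigma : R) (m : nat).
Hypotheses (cf : is_convex_fun f) (sf : SPB f R1 R2 m) (sigma0 : 0 < sigma).
Variables (A : set 'rV[R]_d) (p : 'rV[R]_d -> 'rV[R]_d) (x0 : 'rV[R]_d).
Hypotheses (cA : is_convex_set A) (pA : is_projection A p) (Ax0 : A x0).
Variables (tau : nat -> R) (d0 : measure_display) (T : measurableType d0)
  (P : probability T R) (u : nat -> 'I_d -> T -> R) (x : nat -> T -> 'rV[R]_d).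
Hypotheses (mu : forall k i, measurable_fun setT (u k i))
  (iu : mutually_independent P (fun q : nat * 'I_d => u q.1 q.2))
  (nu : forall k i, std_normal_law P (u k i))
  (x0E : forall w, x 0%N w = x0)
  (xE : forall k w, x k.+1 w = gd_step f sigma m p (tau k) (x k w) (\row_i u k i w)).

Local Notation xi := (iterate f sigma m p x0 tau).

Lemma process_iterate k w : x k w = xi (history u k w).
Proof.
elim: k => [|k IH]; first exact: x0E.
by rewrite xE IH /= lsubmx_history rsubmx_history.
Qed.

Lemma measurable_process k : measurable_fun setT (x k).
Proof.
have -> : x k = (fun w => xi (history u k w)) by apply/funext => w; exact: process_iterate.
apply: (measurableT_comp (@measurable_iterate _ _ _ _ _ sigma _ sf _ _ x0 cA pA tau k)).
apply/measurable_fun_rVP => j; under eq_fun do rewrite mxE.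
exact: mu.
Qed.

Lemma Ex_iterate k (g : 'rV[R]_d -> R) : measurable_fun setT g -> (forall y, 0 <= g y) ->
  Ex P (fun w => g (x k w)) = (\int[gauss (k * d)]_w (g (xi w))%:E)%E.
Proof.
move=> mg g0; rewrite /Ex.
rewrite -(@ge0_integral_independent_normal _ _ _ P _ (fun q : nat * 'I_d => u q.1 q.2)
  _ iu _ (k * d) (@hist_idx d k) (fun v => (g (xi v))%:E)) => //.
- by apply: eq_integral => w _; rewrite process_iterate.
- exact: hist_idx_inj.
- apply/measurable_EFinP; apply: (measurableT_comp mg).
  exact: (measurable_iterate sigma sf x0 cA pA tau).
- by move=> v; rewrite lee_fin.
Qed.

(** Integrates a one-step bound over the past. The gain [b] sits on the left so that no infinite
    values are subtracted; b = 0 serves the minimisers of the smoothing and a multiple of the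
    weighted gap serves the rate. *)
Lemma Ex_step k z (b : 'rV[R]_d -> R) (c : R) : measurable_fun setT b ->
  (forall y, A y -> 0 <= b y) -> 0 <= c ->
  (forall y, A y -> (\int[gauss d]_v (enorm (gd_step f sigma m p (tau k) y v - z) ^+ 2)%:E
     + (b y)%:E <= (enorm (y - z) ^+ 2 + c)%:E)%E) ->
  (Ex P (fun w => (enorm (x k.+1 w - z) ^+ 2)%R) + Ex P (fun w => b (x k w)) <=
   Ex P (fun w => (enorm (x k w - z) ^+ 2)%R) + c%:E)%E.
Proof.
move=> mb b0 c0 H.
have mxi j : measurable_fun setT (@iterate R d f sigma m p x0 tau j).
  exact: (measurable_iterate sigma sf x0 cA pA tau).
have Axi j w : A (@iterate R d f sigma m p x0 tau j w) by exact: iterate_in.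
have mn : measurable_fun setT (fun y : 'rV[R]_d => enorm (y - z) ^+ 2).
  by apply: measurable_funX; apply: measurable_enorm; exact: measurable_rVB.
have n0 (y : 'rV[R]_d) : 0 <= enorm (y - z) ^+ 2 by exact: sqr_ge0.
pose g (w : 'rV[R]_(d + k * d)) := (enorm (@iterate R d f sigma m p x0 tau k.+1 w - z) ^+ 2)%:E.
have mg : measurable_fun setT g.
  by apply/measurable_EFinP; exact: (measurableT_comp mn (mxi k.+1)).
have g0 w : (0 <= g w)%E by rewrite lee_fin.
(* [b] is nonnegative only on [A], where the iterates live; its positive part agrees with it there
   and is nonnegative everywhere. *)
have mb' : measurable_fun setT (fun y => Num.max 0 (b y)) by exact: measurable_maxr.
have b'0 y : 0 <= Num.max 0 (b y) by rewrite le_max lexx.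
have bb' y : A y -> Num.max 0 (b y) = b y by move=> /b0/max_idPr.
have -> : Ex P (fun w => b (x k w)) = Ex P (fun w => Num.max 0 (b (x k w))).
  by apply: eq_integral => w _; rewrite bb'// process_iterate.
rewrite (Ex_iterate k.+1 mn n0) (Ex_iterate k mn n0) (Ex_iterate k mb' b'0).
rewrite (ge0_integral_gaussD mg g0).
have mbk : measurable_fun setT (fun w : 'rV[R]_(k * d) => (Num.max 0 (b (xi w)))%:E).
  by apply/measurable_EFinP; exact: (measurableT_comp mb' (mxi k)).
have mnk : measurable_fun setT (fun w : 'rV[R]_(k * d) => (enorm (xi w - z) ^+ 2)%:E).
  by apply/measurable_EFinP; exact: (measurableT_comp mn (mxi k)).
have mI := measurable_integral_gaussD mg g0.
have I0 w : (0 <= \int[gauss d]_v g (row_mx v w))%E by exact: integral_ge0.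
have -> : c%:E = (\int[@gauss R (k * d)]_w c%:E)%E.
  by rewrite integral_cst// -[LHS]mule1; congr (_ * _)%E; apply/esym; exact: probability_setT.
rewrite -ge0_integralD//; last by move=> w _; rewrite lee_fin.
rewrite -ge0_integralD//.
apply: ge0_le_integral => //.
- by move=> w _; rewrite adde_ge0// lee_fin.
- exact: emeasurable_funD.
- exact: emeasurable_funD.
- move=> w _; rewrite -EFinD bb'//.
  apply: le_trans (H _ (Axi k w)); rewrite leeD2r//.
  by under eq_integral do rewrite /g/= row_mxKl row_mxKr.
- by move=> w _; rewrite lee_fin.
Qed.

End process.

(** * The descent inequality and the rate *)

Unset Implicit Arguments.

Theorem theorem4p5 (R : realType) (d : nat) (Omega : set 'rV[R]_d)
  (proj : 'rV[R]_d -> 'rV[R]_d) (f : 'rV[R]_d -> R) (R1 R2 : R) (m : nat)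
  (xstar : 'rV[R]_d) (sigma : R) (x0 : 'rV[R]_d) (tau : nat -> R)
  (d0 : measure_display) (T : measurableType d0) (P : probability T R)
  (u : nat -> 'I_d -> T -> R) (x : nat -> T -> 'rV[R]_d) :
  Omega !=set0 -> closed Omega -> is_convex_set Omega ->
  is_projection Omega proj ->
  is_convex_fun f -> SPB f R1 R2 m ->
  Omega xstar -> (forall y, Omega y -> f xstar <= f y) ->
  0 < sigma -> Omega x0 -> (forall k, 0 < tau k <= 1) ->
  (forall k i, measurable_fun setT (u k i)) ->
  mutually_independent P (fun p : nat * 'I_d => u p.1 p.2) ->
  (forall k i, std_normal_law P (u k i)) ->
  (forall w, x 0%N w = x0) ->
  (forall k w,
     let U := \row_i u k i w in
     let v := (sigma^-1 * (f (x k w + sigma *: U) - f (x k w))) *: U in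
     x k.+1 w = proj (x k w - (tau k / (enorm (x k w) ^+ m + 1)) *: v)) ->
  let H2 := 3 * Num.max
      (2 `^ (2 * (m%:R - 1)) * R1 ^+ 2 * (4 + d%:R) ^+ 2)
      (R2 ^+ 2 * (4 + d%:R) ^+ 2
        + 2 `^ (2 * (m%:R - 1)) * R1 ^+ 2 * sigma ^+ (2 * m) * ((2 * m + 4 + d)%N%:R) ^+ (m + 2)) in
  let M := fun y : 'rV[R]_d =>
      (2 `^ (m%:R - 1) * R1 * enorm y ^+ m + R2) * Num.sqrt d%:R
      + 2 `^ (m%:R - 1) * R1 * sigma ^+ m * ((m + 1 + d)%N%:R `^ ((m + 1)%N%:R / 2)) in
  (forall z, Omega z -> (forall y, Omega y -> (gauss_smooth f sigma z <= gauss_smooth f sigma y)%E) ->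
     forall k : nat,
       (0 <= Ex P (fun w => (enorm (x k w - z) ^+ 2)%R)
             - Ex P (fun w => (enorm (x k.+1 w - z) ^+ 2)%R) + (H2 * tau k ^+ 2)%:E)%E) /\
  (forall N : nat, (0 < N)%N ->
     (\big[Order.min/+oo%E]_(k < N.+1)
         Ex P (fun w => ((f (x k w) - f xstar) / (enorm (x k w) ^+ m + 1))%R)
      <= ((2 * \sum_(k < N.+1) tau k)^-1
            * (enorm (x0 - xstar) ^+ 2 + H2 * \sum_(k < N.+1) tau k ^+ 2)
          + M xstar * sigma)%:E)%E).
Proof.
move=> _ _ cA pA cf sf Axs xs_min sigma0 Ax0 tau01 mu iu nu x0E xE H2 M.
have tau0 k : 0 < tau k by case/andP: (tau01 k).
have [R10 R20 _ _ _] := sf.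
have mf := SPB_measurable sf.
have H20 : 0 <= H2.
  rewrite mulr_ge0// le_max; apply/orP; left.
  by rewrite mulr_ge0 ?sqr_ge0// mulr_ge0 ?powR_ge0 ?sqr_ge0.
have M0 y : 0 <= M y.
  by rewrite addr_ge0 ?mulr_ge0 ?addr_ge0 ?mulr_ge0 ?powR_ge0 ?exprn_ge0 ?enorm_ge0
    ?sqrtr_ge0 ?(ltW R20) ?(ltW sigma0).
have D1 (y : 'rV[R]_d) : 1 <= enorm y ^+ m + 1 by rewrite lerDr exprn_ge0// enorm_ge0.
have Hc k : 0 <= H2 * tau k ^+ 2 by rewrite mulr_ge0// sqr_ge0.
pose E z k := Ex P (fun w => (enorm (x k w - z) ^+ 2)%R).
have E0 z : E z 0%N = (enorm (x0 - z) ^+ 2)%:E.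
  rewrite /E /Ex; under eq_integral do rewrite x0E.
  by rewrite integral_cst// -[RHS]mule1; congr (_ * _)%E; exact: probability_setT.
have Ege0 z k : (0 <= E z k)%E by apply: integral_ge0 => w _; rewrite lee_fin sqr_ge0.
have step := Ex_step sf cA pA Ax0 mu iu nu x0E xE.
split => [z Az zmin k|N N0].
  have Estep j : (E z j.+1 <= E z j + (H2 * tau j ^+ 2)%:E)%E.
    have := @step j z (fun=> 0) (H2 * tau j ^+ 2) (measurable_cst _)
      (fun _ _ => lexx _) (Hc j).
    rewrite (_ : Ex P (fun=> 0) = 0%E); last by rewrite /Ex integral0.
    rewrite adde0; apply => y Ay; rewrite adde0.
    apply: (le_trans (one_step cf sf sigma0 cA pA y (tau0 j) Az)).
    rewrite lee_fin lerD2r gerBl mulr_ge0//.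
      by rewrite mulr_ge0// divr_ge0 ?(ltW (tau0 j))// (le_trans ler01).
    have := zmin y Ay; rewrite !(gauss_smoothE cf sf sigma0) lee_fin; lra.
  (* Finiteness spreads from the deterministic start by [Estep]; it allows the sum to be turned into
     a difference. *)
  have Efin j : E z j \is a fin_num.
    elim: j => [|j IH]; first by rewrite E0.
    rewrite ge0_fin_numE//; apply: (le_lt_trans (Estep j)).
    by rewrite -(fineK IH) -EFinD ltry.
  rewrite -/(E z k) -/(E z k.+1) addeAC sube_ge0 ?Efin//.
pose G k := Ex P (fun w => ((f (x k w) - f xstar) / (enorm (x k w) ^+ m + 1))%R).
have xA k w : Omega (x k w).
  by case: k => [|k]; rewrite ?x0E// xE; exact: (pA _).1.
have g0 y : Omega y -> 0 <= (f y - f xstar) / (enorm y ^+ m + 1).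
  by move=> Ay; rewrite divr_ge0 ?subr_ge0 ?xs_min// (le_trans ler01).
have Gge0 k : (0 <= G k)%E by apply: integral_ge0 => w _; rewrite lee_fin g0.
pose Ms := M xstar * sigma.
have Ms0 : 0 <= Ms by rewrite mulr_ge0// ltW.
have mg : measurable_fun setT (fun y : 'rV[R]_d => (f y - f xstar) / (enorm y ^+ m + 1)).
  apply: measurable_funM; first exact: measurable_funB.
  exact: measurable_inv_weight.
have Estep k : (E xstar k.+1 + (2 * tau k)%:E * G k <=
    E xstar k + (H2 * tau k ^+ 2 + 2 * tau k * Ms)%:E)%E.
  (* f_s(y) - f_s(xstar) is at least f(y) - f(xstar) - [Ms]; the gap becomes [b], and the error [Ms]
     joins the constant. *)
  pose b (y : 'rV[R]_d) := 2 * tau k * ((f y - f xstar) / (enorm y ^+ m + 1)).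
  have b0 y : Omega y -> 0 <= b y.
    by move=> Ay; rewrite mulr_ge0 ?g0// mulr_ge0// ltW.
  have c0 : 0 <= H2 * tau k ^+ 2 + 2 * tau k * Ms.
    by rewrite addr_ge0// mulr_ge0// mulr_ge0// ltW.
  have mb : measurable_fun setT b by exact: measurable_funM.
  have -> : ((2 * tau k)%:E * G k)%E = Ex P (fun w => b (x k w)).
    rewrite /G /Ex -ge0_integralZl//.
    - apply/measurable_EFinP; apply: (measurableT_comp mg).
      exact: (measurable_process sf cA pA mu x0E xE).
    - by move=> w _; rewrite lee_fin g0.
    - by rewrite lee_fin mulr_ge0// ltW.
  apply: (@step k xstar b _ mb b0 c0) => y Ay.
  apply: (le_trans (leeD (one_step cf sf sigma0 cA pA y (tau0 k) Axs) (lexx _))).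
  rewrite -EFinD lee_fin.
  have s1 := smooth_ge cf sf sigma0 y.
  have s2 := smooth_le cf sf sigma0 xstar.
  rewrite -/(M xstar) -/Ms in s2.
  rewrite /b; set D := enorm y ^+ m + 1; pose q := tau k / D.
  have D0 : 0 < D := lt_le_trans ltr01 (D1 y).
  have q0 : 0 < q by rewrite divr_gt0.
  have qt : q * Ms <= tau k * Ms.
    apply: ler_wpM2r => //; rewrite /q ler_pdivrMr//.
    apply: ler_peMr; [exact/ltW|exact: D1].
  have qs : q * (f y - f xstar - Ms) <= q * (smooth f sigma y - smooth f sigma xstar).
    by rewrite ler_pM2l//; lra.
  have -> : 2 * tau k * ((f y - f xstar) / D) = 2 * (q * (f y - f xstar)).
    by rewrite /q; ring.
  rewrite -/q -/H2; lra.
have tele n : (E xstar n + \sum_(k < n) (2 * tau k)%:E * G k <=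
    (enorm (x0 - xstar) ^+ 2 + \sum_(k < n) (H2 * tau k ^+ 2 + 2 * tau k * Ms))%:E)%E.
  elim: n => [|n IH]; first by rewrite !big_ord0 !addr0 E0.
  rewrite !big_ord_recr/= (addrA (enorm _ ^+ 2)) EFinD addeA addeAC.
  apply: (le_trans (leeD (Estep n) (lexx _))).
  by rewrite addeAC leeD.
set mn := \big[_/_]_(k < _) _.
set bound := _ + M xstar * sigma.
(* The minimum is extended-valued, so it is tested against real lower bounds. Such an r makes the
   telescoped sum at least 2 S r, and division by 2 S turns the accumulated error 2 S [Ms] into
   [Ms]. *)
have key (r : R) : (r%:E <= mn)%E -> r <= bound.
  move=> rmn; pose S := \sum_(k < N.+1) tau k.
  have S0 : 0 < S.
    by rewrite /S big_ord_recl ltr_pwDl// sumr_ge0// => k _; exact/ltW.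
  have : ((2 * S * r)%:E <= \sum_(k < N.+1) (2 * tau k)%:E * G k)%E.
    rewrite /S mulr_sumr mulr_suml -sumEFin; apply: lee_sum => k _.
    rewrite EFinM lee_wpmul2l ?lee_fin ?mulr_ge0 ?(ltW (tau0 k))//.
    by apply: (le_trans rmn); exact: bigmin_le_cond.
  move=> /le_trans/(_ (le_trans (leeDr _ (Ege0 xstar N.+1)) (tele N.+1))).
  rewrite lee_fin big_split/= -mulr_sumr -mulr_suml -mulr_sumr -/S => H.
  rewrite /bound -/S -/Ms -lerBlDr mulrC ler_pdivlMr ?mulr_gt0//; lra.
case: mn key => [r||] key; last exact: leNye.
  by rewrite lee_fin key.
(* An infinite minimum would admit [bound + 1] as a lower bound. *)
have : bound + 1 <= bound by apply: key; exact: leey.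
by rewrite gerDl ler10.
Qed.
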